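(* Let $(M,g_R)$ be a (non-compact) connected complete Riemannian manifold with pointwise norm $\Vert\cdot\Vert_R$, choose $x_0\in M$ and let $d_R(x)$ denote the $g_R$-distance from $x_0$ to $x\in M$. Let $\varphi:[0,\infty)\to(0,\infty)$ be a locally Lipschitz function satisfying $$\int_0^\infty\frac{1}{\varphi(r)}\,dr=\infty .$$ If $h$ is a Riemannian metric on $M$ whose pointwise norm $\Vert\cdot\Vert_h$ satisfies $$\Vert v_x\Vert_h\ge\frac{\Vert v_x\Vert_R}{\varphi(d_R(x))},\qquad \forall x\in M,\ v_x\in T_xM,$$ then $h$ is complete. In particular, this occurs when $\varphi$ grows at most linearly, that is, $\varphi(r)\le a+b\,r$ for some constants $a,b\ge 0$ (necessarily $a>0$), so that $$\Vert v_x\Vert_h\ge\frac{\Vert v_x\Vert_R}{a+b\,d_R(x)},\qquad \forall x\in M,\ v_x\in T_xM.$$ *)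

(* Defs.v *)
From HB Require Import structures.
From mathcomp Require Import all_boot all_order all_algebra.
From mathcomp Require Import all_classical all_reals all_analysis.

Set Implicit Arguments.
Unset Strict Implicit.
Unset Printing Implicit Defensive.

Import Order.TTheory GRing.Theory Num.Theory.
Import numFieldNormedType.Exports.

Local Open Scope classical_set_scope.
Local Open Scope ring_scope.

Fixpoint Ck (R : realType) (V W : normedModType R) (k : nat) (U : set V)
    (f : V -> W) : Prop :=
  match k with
  | 0 => forall x, U x -> {for x, continuous f}
  | k'.+1 => (forall x, U x -> differentiable f x) /\
             (forall v : V, Ck k' U ('D_v f))
  end.

Definition smooth_on (R : realType) (V W : normedModType R) (U : set V)
  (f : V -> W) : Prop := forall k, Ck k U f.

(* [coord] and [param] are mutually inverse homeomorphisms between the open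
   sets [dom] and [cod]; their values elsewhere are irrelevant. *)
Record chart (R : realType) (n : nat) (M : topologicalType) := Chart {
  dom : set M;
  cod : set 'rV[R]_n;
  coord : M -> 'rV[R]_n;
  param : 'rV[R]_n -> M;
  open_dom : open dom;
  open_cod : open cod;
  coord_cod : forall x, dom x -> cod (coord x);
  param_dom : forall y, cod y -> dom (param y);
  coordK : forall x, dom x -> param (coord x) = x;
  paramK : forall y, cod y -> coord (param y) = y;
  coord_continuous_dom : forall x, dom x -> {for x, continuous coord};
  param_continuous_cod : forall y, cod y -> {for y, continuous param}
}.

Definition transition (R : realType) (n : nat) (M : topologicalType)
  (c c' : chart R n M) : 'rV[R]_n -> 'rV[R]_n := coord c' \o param c.

Record manifold (R : realType) (n : nat) := Manifold {
  carrier :> topologicalType;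
  manifold_hausdorff : hausdorff_space carrier;
  manifold_second_countable : @second_countable carrier;
  index : Type;
  atlas : index -> chart R n carrier;
  atlas_cover : forall x, exists i, dom (atlas i) x;
  atlas_smooth : forall i j,
    smooth_on (cod (atlas i) `&` param (atlas i) @^-1` dom (atlas j))
              (transition (atlas i) (atlas j))
}.

Section Manifold.
Context (R : realType) (n : nat) (M : manifold R n).

Definition jac (i j : index M) (x : M) : 'M[R]_n :=
  jacobian (transition (atlas i) (atlas j)) (coord (atlas i) x).

(* An element of T_xM is its family of coordinate vectors in all the charts
   around x.  Vectors are rows, hence Jacobian matrices act on the right. *)
Record tangent (x : M) := Tangent {
  comp : forall i, dom (atlas i) x -> 'rV[R]_n;
  comp_change : forall i j (xi : dom (atlas i) x) (xj : dom (atlas j) x),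
    comp xj = comp xi *m jac i j x
}.

(* [gram i x] is the matrix (g_ab(x)) in the chart i, for x in its domain; the
   last field is the transformation law of covariant 2-tensors. *)
Record riemannian_metric := RiemannianMetric {
  gram : index M -> M -> 'M[R]_n;
  gram_sym : forall i x, dom (atlas i) x -> (gram i x)^T = gram i x;
  gram_posdef : forall i x, dom (atlas i) x ->
    forall u : 'rV[R]_n, u != 0 -> 0 < (u *m gram i x *m u^T) 0 0;
  gram_smooth : forall i,
    smooth_on (cod (atlas i)) (fun y => gram i (param (atlas i) y));
  gram_change : forall i j x, dom (atlas i) x -> dom (atlas j) x ->
    gram i x = jac i j x *m gram j x *m (jac i j x)^T
}.

Definition chart_at (x : M) : index M := sval (cid (atlas_cover x)).

Definition chart_atP (x : M) : dom (atlas (chart_at x)) x :=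
  svalP (cid (atlas_cover x)).

Definition coord_norm (g : riemannian_metric) (i : index M) (x : M)
  (u : 'rV[R]_n) : R := Num.sqrt ((u *m gram g i x *m u^T) 0 0).

(* By [comp_change] and [gram_change], using any other chart around x in place
   of [chart_at x] gives the same value. *)
Definition tnorm (g : riemannian_metric) (x : M) (v : tangent x) : R :=
  coord_norm g (chart_at x) x (comp v (chart_atP x)).

(* The norm of the velocity of [gamma] at time [t]. *)
Definition speed (g : riemannian_metric) (gamma : R -> M) (t : R) : R :=
  let i := chart_at (gamma t) in
  coord_norm g i (gamma t) (derive1 (coord (atlas i) \o gamma) t).

Definition C1_at (gamma : R -> M) (t : R) : Prop :=
  {for t, continuous gamma} /\
  forall i, dom (atlas i) (gamma t) ->
    derivable (coord (atlas i) \o gamma) t 1 /\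
    {for t, continuous (derive1 (coord (atlas i) \o gamma))}.

(* C^1 on the closed interval [a, b]: restriction of a curve that is C^1 on
   an open interval containing it. *)
Definition C1_segment (a b : R) (gamma : R -> M) : Prop :=
  exists (e : R) (delta : R -> M),
    [/\ 0 < e,
        forall t, a - e < t < b + e -> C1_at delta t &
        forall t, a <= t <= b -> delta t = gamma t].

(* Here a < s_0 < ... < s_m = b are the successive breakpoints, or [s] is empty
   and a = b.  Continuity on [a, b] is implied, as the closed pieces overlap at
   the breakpoints. *)
Definition piecewise_C1 (a b : R) (gamma : R -> M) : Prop :=
  exists s : seq R,
    [/\ path <%R a s, last a s = b &
        forall k, (k < size s)%N ->
          C1_segment (nth 0 (a :: s) k) (nth 0 s k) gamma].

Definition length (g : riemannian_metric) (a b : R) (gamma : R -> M) : \bar R :=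
  (\int[lebesgue_measure]_(t in `[a, b]) (speed g gamma t)%:E)%E.

(* Equal to +oo when x and y are in different components. *)
Definition edist (g : riemannian_metric) (x y : M) : \bar R :=
  ereal_inf [set L | exists (a b : R) (gamma : R -> M),
    [/\ piecewise_C1 a b gamma, gamma a = x, gamma b = y &
        L = length g a b gamma]].

(* Meaningful on a connected manifold, where [edist] is finite. *)
Definition dist (g : riemannian_metric) (x y : M) : R := fine (edist g x y).

Definition cauchy_seq (g : riemannian_metric) (u : nat -> M) : Prop :=
  forall e : R, 0 < e -> exists N : nat, forall p q : nat,
    (N <= p)%N -> (N <= q)%N -> (edist g (u p) (u q) < e%:E)%E.

Definition converges_to (g : riemannian_metric) (u : nat -> M) (x : M) : Prop :=
  forall e : R, 0 < e -> exists N : nat, forall p : nat,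
    (N <= p)%N -> (edist g (u p) x < e%:E)%E.

Definition complete_metric (g : riemannian_metric) : Prop :=
  forall u : nat -> M, cauchy_seq g u -> exists x, converges_to g u x.

End Manifold.

(* The library states local properties of pairs near every (r, s) in A * A; the
   off-diagonal pairs only add local boundedness, so this is the usual local
   Lipschitz condition on [0, +oo[. *)
Definition positive_loc_lipschitz (R : realType) (phi : R -> R) : Prop :=
  (forall r, 0 <= r -> 0 < phi r) /\
  [locally [lipschitz phi r | r in `[0, +oo[ ]].

Definition inv_integral_infinite (R : realType) (phi : R -> R) : Prop :=
  (\int[lebesgue_measure]_(r in `[0%R, +oo[) ((phi r)^-1)%:E = +oo)%E.

(* |v|_h >= |v|_gR / phi(d_R(x)) for all x in M and v in T_xM *)
Definition norm_bound (R : realType) (n : nat) (M : manifold R n)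
    (gR h : riemannian_metric M) (x0 : M) (phi : R -> R) : Prop :=
  forall (x : M) (v : tangent x),
    tnorm gR v / phi (dist gR x0 x) <= tnorm h v.

(* Main.v *)
From HB Require Import structures.
From mathcomp Require Import all_boot all_order all_algebra.
From mathcomp Require Import all_classical all_reals all_analysis.
From mathcomp Require Import measurable_realfun ring lra.
Require Import Defs.

(** Write d for the gR-distance from x0 and L_h for the h-length of a curve.
    Along a piecewise C^1 curve gamma the gR-length controls the variation of d,
    and the hypothesis on h says that the gR-speed is at most phi(d(gamma))
    times the h-speed.  Hence the integral of 1/phi from d(gamma(a)) to
    d(gamma(b)) is bounded by L_h(gamma): a curve of finite h-length cannot use
    up the infinite total mass of 1/phi, so d stays bounded on every h-ball
    ([wint_le_length], [ball_dist_bounded]).  On a region where d is bounded,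
    1/phi is bounded below by a positive constant, so h dominates a multiple of
    gR along all short h-curves issuing from the tail of an h-Cauchy sequence.
    The sequence is therefore gR-Cauchy and has a gR-limit; since both distances
    induce the topology of M ([near_edist], [edist_nbhs]), it h-converges to the
    same point ([complete_of_weight]).

    As d composed with a curve is only locally Lipschitz, the integral estimate
    is not obtained by differentiation.  It is proved up to a factor 2, which is
    harmless, near each time of the curve, where continuity makes phi(d(gamma))
    almost constant; both sides being additive in time, the local estimates add
    up ([interval_induction], [length_ge]).

    Everything is expressed with the weight f = 1/phi, prolonged to the whole
    line by a constant on the negative side so that it is continuous everywhere.
    For phi(r) = a + b r the total mass is infinite because each of the
    intervals [2^k - 1, 2^(k+1) - 1] carries a mass bounded away from 0
    ([integral_inv_affine]).

    Distances between nearby points are estimated for both directions of travel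
    at once, and only combined through the triangle inequality, so that curves
    are concatenated but never reversed. *)

Set Implicit Arguments.
Unset Strict Implicit.
Unset Printing Implicit Defensive.

Import Order.TTheory GRing.Theory Num.Theory.
Import numFieldNormedType.Exports.

Local Open Scope classical_set_scope.
Local Open Scope ring_scope.

(** * Induction along an interval *)

(** A supremum argument: P a t holds up to a largest time, which transitivity and
    the local hypothesis push to b.  It replaces the choice of a fine partition
    when an estimate additive in time is only known near each time. *)
Lemma interval_induction (R : realType) (P : R -> R -> Prop) (a b : R) :
  a <= b ->
  (forall s t u, a <= s -> s <= t -> t <= u -> u <= b ->
     P s t -> P t u -> P s u) ->
  (forall t, a <= t <= b -> exists2 e, 0 < e &
     forall s s', a <= s -> s <= s' -> s' <= b -> t - e < s -> s' < t + e ->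
       P s s') ->
  P a b.
Proof.
move=> ab Ptrans Ploc.
pose S := [set t | a <= t <= b /\ P a t].
have Sa : S a.
  split; first by rewrite lexx.
  have [|e e0 Pe] := Ploc a; first by rewrite lexx.
  by apply: Pe => //; lra.
have Sub : ubound S b by move=> t [/andP[]].
have hS : has_sup S by split; [exists a|exists b].
have aT : a <= sup S by apply: sup_upper_bound.
have Tb : sup S <= b by apply: ge_sup => //; exists a.
have [|e e0 Pe] := Ploc (sup S); first by rewrite aT.
have [s [/andP[sa sb] Pas] sT] := sup_adherent e0 hS.
have sS : s <= sup S by apply: sup_upper_bound => //; split; rewrite ?sa.
have [bT|Tb'] := leP b (sup S + e / 2).
  by apply: (Ptrans a s b) => //; apply: Pe => //; lra.
have SU : S (sup S + e / 2).
  split; first by apply/andP; split; lra.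
  by apply: (Ptrans a s) => //; [lra|lra|apply: Pe => //; lra].
have := sup_upper_bound hS SU; lra.
Qed.

(** * Integrals over compact intervals *)

Section interval_integral.
Context (R : realType).
Local Notation mu := (@lebesgue_measure R).
Local Open Scope ereal_scope.


Lemma integral_itv_cat (f : R -> R) (a b c : R) : (a <= b)%R -> (b <= c)%R ->
  (forall x, 0 <= f x)%R -> measurable_fun `[a, c] f ->
  \int[mu]_(x in `[a, c]) (f x)%:E =
  \int[mu]_(x in `[a, b]) (f x)%:E + \int[mu]_(x in `[b, c]) (f x)%:E.
Proof.
move=> ab bc f0 mf.
have mf' : measurable_fun `[a, c] (EFin \o f) by apply/measurable_EFinP.
have U : `[a, c]%classic = `[a, b]%classic `|` `]b, c]%classic.
  apply/seteqP; split=> x /=; rewrite !in_itv/=.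
    by move=> /andP[ax xc]; have [xb|bx] := leP x b; [left|right];
      apply/andP; split.
  by move=> [/andP[? ?]|/andP[? ?]]; apply/andP; split; lra.
rewrite {1}U ge0_integral_setU//; last 3 first.
- by rewrite -U.
- by move=> x _; rewrite lee_fin.
- apply/disj_setPS => x [] /=; rewrite !in_itv/= => /andP[_ xb] /andP[bx _].
  by move: (lt_le_trans bx xb); rewrite ltxx.
congr (_ + _).
rewrite integral_itv_obnd_cbnd//; apply: measurable_funS mf' => //.
by move=> x /=; rewrite !in_itv/= => /andP[? ?]; apply/andP; split; lra.
Qed.

Lemma integral_itv_pt (f : R -> \bar R) (a : R) :
  \int[mu]_(x in `[a, a]) f x = 0.
Proof. by rewrite set_itv1 integral_set1. Qed.

(** The pointwise bound is only asked strictly inside the interval, because the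
    speed of a curve takes an accidental value at its breakpoints. *)
Lemma le_integral_itv (f g : R -> R) (a b : R) :
  measurable_fun `[a, b] f -> measurable_fun `[a, b] g ->
  (forall x, 0 <= f x)%R ->
  (forall x, (a < x < b)%R -> (f x <= g x)%R) ->
  \int[mu]_(x in `[a, b]) (f x)%:E <= \int[mu]_(x in `[a, b]) (g x)%:E.
Proof.
move=> mf mg f0 fg.
have S : `]a, b[%classic `<=` `[a, b]%classic.
  by move=> x /=; rewrite !in_itv/= => /andP[? ?]; apply/andP; split; lra.
rewrite (integral_itv_bndoo true false); last first.
  by apply/measurable_EFinP; apply: measurable_funS mf.
rewrite (integral_itv_bndoo true false (f := EFin \o g)); last first.
  by apply/measurable_EFinP; apply: measurable_funS mg.
apply: ge0_le_integral => //=.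
- by move=> x _; rewrite lee_fin.
- by apply/measurable_EFinP; apply: measurable_funS mf.
- by apply/measurable_EFinP; apply: measurable_funS mg.
Qed.

Lemma integral_itv_cst (k a b : R) : (a <= b)%R ->
  \int[mu]_(x in `[a, b]) (k)%:E = (k * (b - a))%:E.
Proof.
move=> ab; rewrite integral_cst//= lebesgue_measure_itv/= lte_fin.
case: ltP => ab'; first by rewrite -EFinB -EFinM.
by have -> : a = b by [lra]; rewrite subrr mulr0 mule0.
Qed.

Lemma integral_itvZl (f : R -> R) (k a b : R) : (0 <= k)%R ->
  (forall x, 0 <= f x)%R -> measurable_fun `[a, b] f ->
  \int[mu]_(x in `[a, b]) (k * f x)%:E = k%:E * \int[mu]_(x in `[a, b]) (f x)%:E.
Proof.
move=> k0 f0 mf; rewrite -ge0_integralZl//.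
- exact/measurable_EFinP.
- by move=> x _; rewrite lee_fin.
Qed.

Local Notation shift c :=
  ((fun x : R => x + c)%R : measurableTypeR R -> measurableTypeR R).

Lemma lebesgue_measureD (c : R) (A : set R) : measurable A ->
  pushforward mu (shift c) A = mu A.
Proof.
have mc : measurable_fun setT (shift c).
  exact: measurable_funD.
pose m := isMeasurableFun.Build _ _ _ _ _ mc.
pose p : {mfun _ >-> _} := HB.pack (shift c) m.
move=> mA; apply/esym.
apply: (lebesgue_measure_unique (mu := pushforward mu p)) => //= _ [[x y]] _ <-.
rewrite /pushforward/=.
have -> : (fun x : R => x + c)%R @^-1` `]x, y]%classic = `](x - c)%R, (y - c)%R]%classic.
  by apply/seteqP; split=> z /=; rewrite !in_itv/= => /andP[? ?]; apply/andP; split; lra.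
rewrite !lebesgue_measure_itv/= !lte_fin ltrD2r; case: ifPn => // _.
by rewrite -!EFinB; congr EFin; ring.
Qed.

Lemma integral_itv_shift (f : R -> R) (a b c : R) :
  (forall x, 0 <= f x)%R -> measurable_fun `[a, b] f ->
  \int[mu]_(x in `[(a - c)%R, (b - c)%R]) (f (x + c)%R)%:E =
  \int[mu]_(x in `[a, b]) (f x)%:E.
Proof.
move=> f0 mf.
have mc : measurable_fun setT (shift c).
  exact: measurable_funD.
have -> : `[(a - c)%R, (b - c)%R]%classic = (fun x : R => x + c)%R @^-1` `[a, b]%classic.
  by apply/seteqP; split=> z /=; rewrite !in_itv/= => /andP[? ?]; apply/andP; split; lra.
rewrite -[LHS](ge0_integral_pushforward mc mu (f := EFin \o f))//.
- by apply: eq_measure_integral => //= A mA _; exact/lebesgue_measureD.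
- exact/measurable_EFinP.
- by move=> x _; rewrite lee_fin.
Qed.

End interval_integral.

(** * Weights of infinite mass *)

Section weights.
Context (R : realType).
Local Notation mu := (@lebesgue_measure R).
Local Open Scope ereal_scope.

(** The mass of [0, r0] is finite since f is bounded there, so the mass of
    [r0, +oo[ is infinite and its truncations exceed any B. *)
Lemma integral_unbounded (f : R -> R) (r0 B : R) :
  (forall x, 0 <= f x)%R -> continuous f ->
  \int[mu]_(r in `[0%R, +oo[) (f r)%:E = +oo -> (0 <= r0)%R ->
  exists2 K, (r0 <= K)%R & B%:E < \int[mu]_(r in `[r0, K]) (f r)%:E.
Proof.
move=> f0 cf foo r00; apply: contrapT => nK.
have mf A : measurable_fun A f.
  by apply: measurable_funTS; exact: continuous_measurable_fun.
pose I0 := \int[mu]_(r in `[0%R, r0]) (f r)%:E.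
have I0fin : I0 < +oo.
  have [|c _ fc] := @EVT_max R f 0%R r0 r00.
    by apply: continuous_subspaceT.
  apply: (@le_lt_trans _ _ (\int[mu]_(r in `[0%R, r0]) (f c)%:E)).
    by apply: le_integral_itv => // x /andP[? ?]; apply: fc; rewrite in_itv/= !ltW.
  by rewrite integral_itv_cst// ltry.
have bnd k : \int[mu]_(r in `[0%R, k%:R]) (f r)%:E <= I0 + B%:E.
  have [kr|rk] := leP k%:R r0.
    apply: (@le_trans _ _ I0).
      rewrite /I0 (integral_itv_cat (ler0n R k) kr)//.
      by rewrite leeDl// integral_ge0// => x _; rewrite lee_fin.
    rewrite leeDl// leNgt; apply/negP => B0; apply: nK; exists r0 => //.
    by rewrite integral_itv_pt.
  rewrite (integral_itv_cat r00 (ltW rk))// leeD2l// leNgt; apply/negP => BK.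
  by apply: nK; exists k%:R => //; exact: ltW.
have /cvg_lim L := @ge0_cvgn_integral R mu f f0 (mf setT).
have : \int[mu]_(r in `[0%R, +oo[) (f r)%:E <= I0 + B%:E.
  rewrite -L//; apply: lime_le; last exact: nearW.
  by apply/cvg_ex; eexists; exact: (@ge0_cvgn_integral R mu f f0 (mf setT)).
rewrite foo leye_eq => /eqP IB.
have : I0 + B%:E < +oo by rewrite lte_add_pinfty// ltry.
by rewrite IB ltxx.
Qed.

Lemma continuous_inv_affine (a b : R) : (0 < a)%R -> (0 <= b)%R ->
  continuous (fun r : R => (a + b * Num.max r 0)^-1)%R.
Proof.
move=> a0 b0 r; apply: cvgV.
  have : (0 <= b * Num.max r 0)%R by rewrite mulr_ge0// le_max lexx orbT.
  by move=> ?; apply: lt0r_neq0; lra.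
apply: cvgD; first exact: cvg_cst.
apply: cvgM; first exact: cvg_cst.
by apply: continuous_max; [exact: cvg_id|exact: cvg_cst].
Qed.

(** The mass of [2^k - 1, 2^(k+1) - 1], an interval of length 2^k on which
    a + b r is at most (a + b) 2^(k+1), is at least 1 / (2 (a + b)). *)
Lemma integral_inv_affine (a b : R) : (0 < a)%R -> (0 <= b)%R ->
  \int[mu]_(r in `[0%R, +oo[) ((a + b * r)^-1)%:E = +oo.
Proof.
move=> a0 b0.
pose f (r : R) := ((a + b * Num.max r 0)^-1)%R.
have cf : continuous f by exact: continuous_inv_affine.
have fp (x : R) : (0 < a + b * Num.max x 0)%R.
  by apply: ltr_wpDr => //; rewrite mulr_ge0// le_max lexx orbT.
have f0 x : (0 <= f x)%R by rewrite /f invr_ge0 ltW.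
have mf A : measurable_fun A f.
  by apply: measurable_funTS; exact: continuous_measurable_fun.
have -> : \int[mu]_(r in `[0%R, +oo[) ((a + b * r)^-1)%:E =
          \int[mu]_(r in `[0%R, +oo[) (f r)%:E.
  apply: eq_integral => x; rewrite inE/= in_itv/= andbT => x0.
  by rewrite /f max_l.
pose d : R := ((2 * (a + b))^-1)%R.
have ab0 : (0 < a + b)%R by lra.
have d0 : (0 < d)%R by rewrite invr_gt0; lra.
have step k : (k%:R * d)%:E <= \int[mu]_(r in `[0%R, (2 ^+ k - 1)%R]) (f r)%:E.
  elim: k => [|k IH].
    by rewrite mul0r expr0 subrr integral_itv_pt.
  have k1 : (1 <= 2 ^+ k :> R)%R by rewrite exprn_ege1// ler1n.
  rewrite exprS.
  rewrite (@integral_itv_cat _ _ 0%R (2 ^+ k - 1)%R (2 * 2 ^+ k - 1)%R)//; [|lra|lra].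
  rewrite -natr1 mulrDl mul1r EFinD; apply: leeD => //.
  pose c : R := ((a + b) * (2 * 2 ^+ k))%R.
  have c0 : (0 < c)%R by rewrite /c; apply: mulr_gt0 => //; lra.
  apply: (@le_trans _ _ (\int[mu]_(r in `[(2 ^+ k - 1)%R, (2 * 2 ^+ k - 1)%R]) (c^-1)%:E)).
    rewrite integral_itv_cst; last lra.
    rewrite lee_fin /c /d le_eqVlt; apply/orP; left; apply/eqP; field.
    by apply/andP; split; apply: lt0r_neq0; lra.
  apply: le_integral_itv => //; first by move=> _; rewrite invr_ge0 ltW.
  move=> x /andP[x1 x2]; rewrite /f lef_pV2 ?posrE// /c max_l; last lra.
  have : (b * x <= b * (2 * 2 ^+ k - 1))%R by rewrite ler_wpM2l// ltW.
  have : (a * 1 <= a * (2 * 2 ^+ k))%R by rewrite ler_wpM2l ?ltW//; lra.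
  by lra.
apply/eqP; rewrite -leye_eq leNgt; apply/negP => fin.
have [v Ev] : exists v, \int[mu]_(r in `[0%R, +oo[) (f r)%:E = v%:E.
  exists (fine (\int[mu]_(r in `[0%R, +oo[) (f r)%:E)); rewrite fineK// ge0_fin_numE//.
  by apply: integral_ge0 => x _; rewrite lee_fin.
have bnd k : (k%:R * d <= v)%R.
  rewrite -lee_fin -Ev; apply: (le_trans (step k)).
  apply: ge0_subset_integral => //=.
  - by apply/measurable_EFinP; apply: mf.
  - by move=> x _; rewrite lee_fin.
  - by move=> x /=; rewrite !in_itv/= => /andP[-> _].
have := bnd (Num.truncn (v / d)).+1; apply/negP; rewrite -ltNge -ltr_pdivrMr//.
exact: truncnS_gt.
Qed.

End weights.

(** * Charts, tangent vectors and speed *)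

Section quadratic_forms.
Context (R : realType) (n : nat).

Definition qform (G : 'M[R]_n) (u : 'rV[R]_n) : R := (u *m G *m u^T) 0 0.

Lemma qformE (G : 'M[R]_n) (u : 'rV[R]_n) :
  qform G u = \sum_(j < n) (\sum_(i < n) u 0 i * G i j) * u 0 j.
Proof.
by rewrite /qform mxE; apply: eq_bigr => j _; rewrite !mxE.
Qed.

Lemma cvg_qform (T : Type) (F : set_system T) (FF : Filter F)
    (G : T -> 'M[R]_n) (u : T -> 'rV[R]_n) (G0 : 'M[R]_n) (u0 : 'rV[R]_n) :
  G @ F --> G0 -> u @ F --> u0 -> (fun t => qform (G t) (u t)) @ F --> qform G0 u0.
Proof.
move=> cG cu; under eq_fun do rewrite qformE; rewrite qformE.
have cuij i : (fun t => u t 0 i) @ F --> u0 0 i.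
  exact: (cvg_comp u (fun v : 'rV[R]_n => v 0 i) cu (@coord_continuous R 1 n 0 i u0)).
apply: cvg_big => //; first exact: add_continuous.
move=> j _; apply: cvgM => //.
apply: cvg_big => //; first exact: add_continuous.
move=> i _; apply: cvgM => //.
exact: (cvg_comp G (fun v : 'M[R]_n => v i j) cG (@coord_continuous R n n i j G0)).
Qed.

End quadratic_forms.

Section charts.
Context (R : realType) (n : nat) (M : manifold R n).
Implicit Types (i j k : index M) (x : M).

Lemma near_dom i x : dom (atlas i) x -> \forall y \near x, dom (atlas i) y.
Proof. by move=> xi; apply: open_nbhs_nbhs; split => //; exact: open_dom. Qed.

Lemma near_cod i (p : 'rV[R]_n) : cod (atlas i) p ->
  \forall q \near p, cod (atlas i) q.
Proof. by move=> pi; apply: open_nbhs_nbhs; split => //; exact: open_cod. Qed.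

Lemma near_overlap i j x : dom (atlas i) x -> dom (atlas j) x ->
  \forall p \near coord (atlas i) x,
    cod (atlas i) p /\ dom (atlas j) (param (atlas i) p).
Proof.
move=> xi xj; near=> p; split; near: p.
  by apply: near_cod; exact: coord_cod.
have := @param_continuous_cod _ _ _ (atlas i) _ (coord_cod xi).
by apply; rewrite coordK//; exact: near_dom.
Unshelve. all: by end_near. Qed.

Lemma transition_coord i j x : dom (atlas i) x ->
  transition (atlas i) (atlas j) (coord (atlas i) x) = coord (atlas j) x.
Proof. by move=> xi; rewrite /transition/= coordK. Qed.

Lemma transition_C1 i j : Ck 1
  (cod (atlas i) `&` param (atlas i) @^-1` dom (atlas j))
  (transition (atlas i) (atlas j)).
Proof. exact: atlas_smooth. Qed.

Lemma differentiable_transition i j x : dom (atlas i) x -> dom (atlas j) x ->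
  differentiable (transition (atlas i) (atlas j)) (coord (atlas i) x).
Proof.
move=> xi xj; have [+ _] := transition_C1 i j; apply; split.
  exact: coord_cod.
by rewrite /= coordK.
Qed.

Lemma mul_jac i j x (v : 'rV[R]_n) : dom (atlas i) x -> dom (atlas j) x ->
  v *m jac i j x = 'D_v (transition (atlas i) (atlas j)) (coord (atlas i) x).
Proof.
by move=> xi xj; rewrite /jac deriveEjacobian//; exact: differentiable_transition.
Qed.

(** The chain rule: near the point, the transition from i to k is the composite
    of those from i to j and from j to k. *)
Lemma jac_cocycle i j k x :
  dom (atlas i) x -> dom (atlas j) x -> dom (atlas k) x ->
  jac i k x = jac i j x *m jac j k x.
Proof.
move=> xi xj xk; apply/row_matrixP => a; rewrite !rowE mulmxA.
set v := delta_mx 0 a.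
have dij := differentiable_transition xi xj.
have djk := differentiable_transition xj xk.
have djk' : differentiable (transition (atlas j) (atlas k))
    (transition (atlas i) (atlas j) (coord (atlas i) x)).
  by rewrite transition_coord.
have e1 := mul_jac v xi xk; have e2 := mul_jac v xi xj.
have e3 := mul_jac ('D_v (transition (atlas i) (atlas j)) (coord (atlas i) x)) xj xk.
move: (jac i k x) (jac i j x) (jac j k x) e1 e2 e3 => A B C -> -> -> {A B C}.
transitivity ('D_v (transition (atlas j) (atlas k) \o
                    transition (atlas i) (atlas j)) (coord (atlas i) x)).
  apply: near_eq_derive; near=> p.
  have [_ pj] : cod (atlas i) p /\ dom (atlas j) (param (atlas i) p).
    by near: p; exact: near_overlap.
  by rewrite /transition/= coordK.
rewrite deriveE; last exact: differentiable_comp.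
by rewrite diff_comp//= -deriveE// -deriveE// transition_coord.
Unshelve. all: by end_near. Qed.

Lemma jac_same i x : dom (atlas i) x -> jac i i x = 1%:M.
Proof.
move=> xi; apply/row_matrixP => a; rewrite !rowE mulmx1.
rewrite mul_jac//.
rewrite (@near_eq_derive _ _ _ _ id) ?derive_id//.
near=> p.
have [pi _] : cod (atlas i) p /\ dom (atlas i) (param (atlas i) p).
  by near: p; exact: near_overlap.
by rewrite /transition/= paramK.
Unshelve. all: by end_near. Qed.

(** The cocycle identity makes the images of w under the Jacobians a coherent
    family.  Hence a bound on all tangent vectors is a bound on all rows in the
    chart chosen at x, which is the chart that the speed of a curve uses. *)
Lemma tangent_of (x : M) (w : 'rV[R]_n) :
  exists v : tangent x, comp v (chart_atP x) = w.
Proof.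
pose c := chart_at x.
have cP (i j : index M) (xi : dom (atlas i) x) (xj : dom (atlas j) x) :
    w *m jac c j x = w *m jac c i x *m jac i j x.
  by rewrite -mulmxA -jac_cocycle//; exact: chart_atP.
exists (@Tangent _ _ _ x (fun i _ => w *m jac c i x) cP) => /=.
by rewrite jac_same ?mulmx1//; exact: chart_atP.
Qed.

Lemma norm_bound_coord (gR h : riemannian_metric M) (x0 : M) (phi : R -> R) :
  norm_bound gR h x0 phi -> forall (x : M) (w : 'rV[R]_n),
  coord_norm gR (chart_at x) x w / phi (dist gR x0 x)
    <= coord_norm h (chart_at x) x w.
Proof. by move=> nb x w; have [v <-] := tangent_of x w; exact: nb. Qed.

Lemma coord_norm_change (g : riemannian_metric M) i j x (u : 'rV[R]_n) :
  dom (atlas i) x -> dom (atlas j) x ->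
  coord_norm g i x u = coord_norm g j x (u *m jac i j x).
Proof.
by move=> xi xj; rewrite /coord_norm (gram_change _ xi xj) trmx_mul !mulmxA.
Qed.

Lemma coord_norm_ge0 (g : riemannian_metric M) i x u : 0 <= coord_norm g i x u.
Proof. exact: sqrtr_ge0. Qed.

Lemma speed_ge0 (g : riemannian_metric M) gamma t : 0 <= speed g gamma t.
Proof. exact: coord_norm_ge0. Qed.

Lemma near_curve (gamma : R -> M) t i : {for t, continuous gamma} ->
  dom (atlas i) (gamma t) -> \forall s \near t, dom (atlas i) (gamma s).
Proof. by move=> cg ti; apply: cg; exact: near_dom. Qed.

(** The chain rule for the coordinates of a curve read in two charts. *)
Lemma derive1_coord_change (gamma : R -> M) t i j : {for t, continuous gamma} ->
  dom (atlas i) (gamma t) -> dom (atlas j) (gamma t) ->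
  derivable (coord (atlas i) \o gamma) t 1 ->
  derive1 (coord (atlas j) \o gamma) t =
  derive1 (coord (atlas i) \o gamma) t *m jac i j (gamma t).
Proof.
move=> cg ti tj di.
have dij := differentiable_transition ti tj.
rewrite !derive1E mul_jac//.
transitivity ('D_1 (transition (atlas i) (atlas j) \o (coord (atlas i) \o gamma)) t).
  apply: near_eq_derive; near=> s; rewrite /transition/= coordK//.
  by near: s; exact: near_curve.
have /derivable1_diffP di' := di.
rewrite deriveE; last exact: differentiable_comp.
by rewrite diff_comp//= -deriveE// -deriveE.
Unshelve. all: by end_near. Qed.

(** The chart in which the speed is computed depends on the time; this formula
    in a fixed chart is what makes the speed a continuous function of time. *)
Lemma speedE (g : riemannian_metric M) (gamma : R -> M) t i : C1_at gamma t ->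
  dom (atlas i) (gamma t) ->
  speed g gamma t = coord_norm g i (gamma t) (derive1 (coord (atlas i) \o gamma) t).
Proof.
move=> [cg d] ti; set j := chart_at (gamma t).
have tj : dom (atlas j) (gamma t) by exact: chart_atP.
rewrite /speed -/j (@derive1_coord_change gamma t i j)//; last by case: (d i ti).
by rewrite (coord_norm_change _ _ ti tj).
Qed.

Lemma gram_cvg (g : riemannian_metric M) i (p : 'rV[R]_n) : cod (atlas i) p ->
  gram g i (param (atlas i) q) @[q --> p] --> gram g i (param (atlas i) p).
Proof. by move=> pi; have := gram_smooth g i 0; apply. Qed.

Lemma continuous_speed (g : riemannian_metric M) (gamma : R -> M) t :
  (\forall s \near t, C1_at gamma s) -> {for t, continuous (speed g gamma)}.
Proof.
move=> C; have Ct := nbhs_singleton C; have [cg d] := Ct.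
set i := chart_at (gamma t).
have ti : dom (atlas i) (gamma t) by exact: chart_atP.
rewrite /prop_for /continuous_at (speedE g Ct ti).
have cc : coord (atlas i) \o gamma @ t --> coord (atlas i) (gamma t).
  by apply: continuous_comp => //; exact: coord_continuous_dom.
suff : (fun s => coord_norm g i (param (atlas i) (coord (atlas i) (gamma s)))
    (derive1 (coord (atlas i) \o gamma) s)) @ t -->
    coord_norm g i (gamma t) (derive1 (coord (atlas i) \o gamma) t).
  apply: cvg_trans; apply: near_eq_cvg; near=> s.
  have si : dom (atlas i) (gamma s) by near: s; exact: near_curve.
  by rewrite (@speedE _ _ _ i) ?coordK//; near: s.
apply: continuous_cvg; first exact: sqrt_continuous.
apply: (@cvg_qform R n _ (nbhs t)); last by have [] := d i ti.
rewrite -[in X in _ --> X](coordK ti).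
apply: (cvg_comp _ (fun p => gram g i (param (atlas i) p)) cc).
by apply: gram_cvg; exact: coord_cod.
Unshelve. all: by end_near. Qed.

Lemma speed_near (g : riemannian_metric M) (gamma delta : R -> M) t :
  (\forall s \near t, gamma s = delta s) -> speed g gamma t = speed g delta t.
Proof.
move=> E; rewrite /speed (nbhs_singleton E).
set i := chart_at _; congr (coord_norm _ _ _ _).
rewrite !derive1E; apply: near_eq_derive; near=> s => /=.
by congr (coord (atlas i) _); near: s.
Unshelve. all: by end_near. Qed.

Lemma speed_shift (g : riemannian_metric M) (gamma : R -> M) c t :
  speed g (fun s => gamma (s + c)) t = speed g gamma (t + c).
Proof.
rewrite /speed; congr (coord_norm _ _ _ _).
rewrite /derive1; set F := fun h : R => _ *: _; set G := fun h : R => _ *: _.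
suff -> : F = G by [].
by apply/funext => h; rewrite /F /G /= addrA.
Qed.

End charts.

(** * Piecewise C^1 curves and their lengths *)

Section curves.
Context (R : realType) (n : nat) (M : manifold R n).
Implicit Types (gamma delta : R -> M) (a b c s t : R).

Lemma C1_at_shift gamma c t : C1_at gamma (t + c) ->
  C1_at (fun s => gamma (s + c)) t.
Proof.
have cs : {for t, continuous (fun s : R => s + c)}.
  by apply: cvgD; [exact: cvg_id|exact: cvg_cst].
move=> [cg d]; split; first exact: (continuous_comp cs cg).
move=> i ti; have [di ci] := d i ti; split.
  move: di; rewrite /derivable.
  set F := fun h : R => _ *: _; set G := fun h : R => _ *: _.
  suff -> : F = G by [].
  by apply/funext => h; rewrite /F /G /= addrA.
have -> : derive1 (coord (atlas i) \o (fun s : R => gamma (s + c))) =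
    derive1 (coord (atlas i) \o gamma) \o (fun s => s + c).
  apply/funext => s; rewrite /derive1 /=.
  set F := fun h : R => _ *: _; set G := fun h : R => _ *: _.
  suff -> : F = G by [].
  by apply/funext => h; rewrite /F /G /= addrA.
exact: (continuous_comp cs ci).
Qed.

Lemma C1_segment_ext a b gamma gamma' :
  (forall t, a <= t <= b -> gamma t = gamma' t) ->
  C1_segment a b gamma -> C1_segment a b gamma'.
Proof.
move=> E [e [delta [e0 C D]]]; exists e, delta; split => // t tab.
by rewrite D ?E.
Qed.

Lemma C1_segment_sub a b s t gamma : a <= s -> t <= b ->
  C1_segment a b gamma -> C1_segment s t gamma.
Proof.
move=> as_ tb [e [delta [e0 C D]]]; exists e, delta; split => // u /andP[? ?].
  by apply: C; apply/andP; split; lra.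
by apply: D; apply/andP; split; lra.
Qed.

Lemma C1_segment_shift a b c gamma : C1_segment a b gamma ->
  C1_segment (a - c) (b - c) (fun s => gamma (s + c)).
Proof.
move=> [e [delta [e0 C D]]]; exists e, (fun s => delta (s + c)).
split => // t /andP[? ?].
  by apply: C1_at_shift; apply: C; apply/andP; split; lra.
by apply: D; apply/andP; split; lra.
Qed.

(** The values of gamma outside [a, b] are arbitrary, so continuity can only be
    used along times of the segment. *)
Lemma C1_segment_near a b gamma t (N : set M) : C1_segment a b gamma ->
  a <= t <= b -> nbhs (gamma t) N ->
  exists2 e, 0 < e & forall s, a <= s <= b -> `|s - t| < e -> N (gamma s).
Proof.
move=> [e [delta [e0 C D]]] tab; rewrite -D// => Nt.
have [|cd _] := C t; first by move: tab => /andP[? ?]; apply/andP; split; lra.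
have /nbhs_ballP[r /= r0 rN] := cd _ Nt.
exists r => // s sab st; rewrite -D//; apply: rN.
by rewrite /ball/= distrC.
Qed.

(** On the open interval the curve coincides with a C^1 curve, whose speed is
    continuous; two more points do not affect measurability. *)
Lemma measurable_speed_segment (g : riemannian_metric M) a b gamma :
  C1_segment a b gamma -> measurable_fun `[a, b] (speed g gamma).
Proof.
move=> [e [delta [e0 C D]]].
have mo : measurable_fun `]a, b[ (speed g gamma).
  apply: (@eq_measurable_fun _ _ _ _ _ (speed g delta)).
    move=> t; rewrite inE/= in_itv/= => tab; apply: speed_near.
    near=> s; apply: D; have : s \in `]a, b[ by near: s; apply: near_in_itvoo; rewrite in_itv.
    by rewrite in_itv/= => /andP[? ?]; rewrite !ltW.
  apply: open_continuous_measurable_fun; first exact: interval_open.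
  move=> t; rewrite inE/= => tab; apply: continuous_speed.
  near=> s; apply: C; have : s \in `]a, b[ by near: s; exact: near_in_itvoo.
  by rewrite in_itv/= => /andP[? ?]; apply/andP; split; lra.
have [ab|ba] := leP a b; last first.
  by rewrite set_itv_ge -?leNgt ?bnd_simp//; exact: measurable_fun_set0.
have -> : `[a, b]%classic = ([set a] `|` `]a, b[) `|` [set b] :> set R.
  apply/seteqP; split=> x /=; rewrite !in_itv/=.
    move=> /andP[]; rewrite 2!le_eqVlt => /predU1P[->|ax]; first by left; left.
    by move=> /predU1P[->|xb]; [right|left; right; rewrite ax].
  by move=> [[->|/andP[? ?]]|->]; rewrite ?lexx ?ab// !ltW.
apply/measurable_funU => //; first exact: measurableU.
split; last exact: measurable_fun_set1.
by apply/measurable_funU => //; split => //; exact: measurable_fun_set1.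
Unshelve. all: by end_near. Qed.

Lemma piecewise_C1_refl gamma a : piecewise_C1 a a gamma.
Proof. by exists [::]; split. Qed.

Lemma piecewise_C1_cons gamma a b c : a < b -> C1_segment a b gamma ->
  piecewise_C1 b c gamma -> piecewise_C1 a c gamma.
Proof.
move=> ab C [s [ps ls Cs]]; exists (b :: s); split => /=; [by rewrite ab|by []|].
by case=> [|k] //= ks; apply: Cs.
Qed.

Lemma piecewise_C1_segment gamma a b : a <= b -> C1_segment a b gamma ->
  piecewise_C1 a b gamma.
Proof.
rewrite le_eqVlt => /predU1P[->|ab] C; first exact: piecewise_C1_refl.
by apply: (piecewise_C1_cons ab C); exact: piecewise_C1_refl.
Qed.

(** Induction on the number of pieces, the first piece being split off. *)
Lemma piecewise_C1_ind gamma (Q : R -> R -> Prop) :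
  (forall a, Q a a) ->
  (forall a b c, a < b -> b <= c -> C1_segment a b gamma ->
     piecewise_C1 b c gamma -> Q b c -> Q a c) ->
  forall a b, piecewise_C1 a b gamma -> Q a b.
Proof.
move=> Q0 QS a b [s [ps ls Cs]].
suff [_ []] : a <= b /\ Q a b /\ piecewise_C1 a b gamma by [].
elim: s a ps ls Cs => [|c s IH] a /= => [_ <- _|/andP[ac ps] ls Cs].
  by split; [|split] => //; exact: piecewise_C1_refl.
have [k ks|cb [Qcb pcb]] := IH c ps ls; first exact: (Cs k.+1).
have Cac : C1_segment a c gamma by exact: (Cs 0%N).
split; first by apply: le_trans cb; exact: ltW.
by split; [exact: QS pcb Qcb|exact: piecewise_C1_cons pcb].
Qed.

Lemma piecewise_C1_le gamma a b : piecewise_C1 a b gamma -> a <= b.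
Proof.
elim/piecewise_C1_ind => // {}a {}b c ab bc _ _ _; exact: le_trans (ltW ab) bc.
Qed.

Lemma piecewise_C1_ext gamma gamma' a b :
  (forall t, a <= t <= b -> gamma t = gamma' t) ->
  piecewise_C1 a b gamma -> piecewise_C1 a b gamma'.
Proof.
move=> + p; elim/piecewise_C1_ind: p => [{}a _|]; first exact: piecewise_C1_refl.
move=> {}a {}b c ab bc C _ IH E; apply: (piecewise_C1_cons ab).
  by apply: C1_segment_ext C => t /andP[? ?]; apply: E; apply/andP; split; lra.
by apply: IH => t /andP[? ?]; apply: E; apply/andP; split; lra.
Qed.

Lemma piecewise_C1_shift gamma a b c : piecewise_C1 a b gamma ->
  piecewise_C1 (a - c) (b - c) (fun s => gamma (s + c)).
Proof.
elim/piecewise_C1_ind => [{}a|{}a {}b d ab bd C _ IH].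
  exact: piecewise_C1_refl.
apply: piecewise_C1_cons IH; first lra.
exact: C1_segment_shift.
Qed.

Lemma piecewise_C1_cat gamma a b c : piecewise_C1 a b gamma ->
  piecewise_C1 b c gamma -> piecewise_C1 a c gamma.
Proof.
elim/piecewise_C1_ind => // {}a {}b d ab bd C _ IH /IH p.
exact: piecewise_C1_cons p.
Qed.

Lemma piecewise_C1_prefix gamma a b t : piecewise_C1 a b gamma ->
  a <= t <= b -> piecewise_C1 a t gamma.
Proof.
move=> p; elim/piecewise_C1_ind: p => [{}a at_|{}a {}b c ab bc C p IH /andP[at_ tc]].
  by have -> : t = a; [lra|exact: piecewise_C1_refl].
have [tb|bt] := leP t b.
  by apply: piecewise_C1_segment => //; exact: C1_segment_sub C.
by apply: (piecewise_C1_cons ab C); apply: IH; rewrite ltW.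
Qed.

Lemma measurable_speed (g : riemannian_metric M) gamma a b :
  piecewise_C1 a b gamma -> measurable_fun `[a, b] (speed g gamma).
Proof.
elim/piecewise_C1_ind => [{}a|{}a {}b c ab bc C p IH].
  by rewrite set_itv1; exact: measurable_fun_set1.
have -> : `[a, c]%classic = `[a, b] `|` `[b, c] :> set R.
  apply/seteqP; split=> x /=; rewrite !in_itv/=.
    by move=> /andP[? ?]; have [?|?] := leP x b; [left|right]; apply/andP; split; lra.
  by move=> [|] /andP[? ?]; apply/andP; split; lra.
apply/measurable_funU => //; split => //.
exact: measurable_speed_segment.
Qed.

Local Open Scope ereal_scope.

Lemma length_pt (g : riemannian_metric M) gamma a : length g a a gamma = 0.
Proof. exact: integral_itv_pt. Qed.

Lemma length_ge0 (g : riemannian_metric M) gamma a b : 0 <= length g a b gamma.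
Proof. by apply: integral_ge0 => t _; rewrite lee_fin speed_ge0. Qed.

Lemma length_cat (g : riemannian_metric M) gamma a b c :
  piecewise_C1 a b gamma -> piecewise_C1 b c gamma ->
  length g a c gamma = length g a b gamma + length g b c gamma.
Proof.
move=> p q; apply: integral_itv_cat.
- exact: piecewise_C1_le p.
- exact: piecewise_C1_le q.
- by move=> t; exact: speed_ge0.
- by apply: measurable_speed; exact: piecewise_C1_cat q.
Qed.

Lemma length_ext (g : riemannian_metric M) gamma gamma' a b :
  (forall t, (a <= t <= b)%R -> gamma t = gamma' t) ->
  piecewise_C1 a b gamma -> length g a b gamma = length g a b gamma'.
Proof.
move=> E p; have p' := piecewise_C1_ext E p.
have S : `]a, b[%classic `<=` `[a, b]%classic.
  by move=> x /=; rewrite !in_itv/= => /andP[? ?]; apply/andP; split; lra.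
apply: eq_integral_itv_bounded.
- exact: measurable_funS S (measurable_speed g p).
- exact: measurable_funS S (measurable_speed g p').
- move=> t tab; apply: speed_near; near=> s; apply: E.
  have : s \in `]a, b[ by near: s; exact: near_in_itvoo.
  by rewrite in_itv/= => /andP[? ?]; rewrite !ltW.
Unshelve. all: by end_near. Qed.

Lemma length_shift (g : riemannian_metric M) gamma a b c :
  piecewise_C1 a b gamma ->
  length g (a - c) (b - c) (fun s => gamma (s + c)%R) = length g a b gamma.
Proof.
move=> p; rewrite /length.
under eq_integral do rewrite speed_shift.
apply: (@integral_itv_shift _ (speed g gamma)).
- by move=> t; exact: speed_ge0.
- exact: measurable_speed.
Qed.

(** A quantity that is subadditive along a curve is bounded by the length as soon
    as it is so on short arcs: length is additive, so interval induction applies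
    on each C^1 piece. *)
Lemma length_ge (g : riemannian_metric M) gamma (F : R -> R -> \bar R) a b :
  (forall s, F s s <= 0) ->
  (forall s t u, (s <= t)%R -> (t <= u)%R -> F s u <= F s t + F t u) ->
  (forall p q t, C1_segment p q gamma -> (p <= t <= q)%R ->
     exists2 e, (0 < e)%R & forall s s', (p <= s)%R -> (s <= s')%R -> (s' <= q)%R ->
      (t - e < s)%R -> (s' < t + e)%R -> F s s' <= length g s s' gamma) ->
  piecewise_C1 a b gamma -> F a b <= length g a b gamma.
Proof.
move=> F0 Ftri Floc; elim/piecewise_C1_ind => [{}a|{}a {}b c ab bc C p IH].
  by rewrite length_pt.
have pC s t : (a <= s)%R -> (s <= t)%R -> (t <= b)%R -> piecewise_C1 s t gamma.
  by move=> ? ? ?; apply: piecewise_C1_segment => //; apply: C1_segment_sub C.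
rewrite (length_cat g (pC _ _ (lexx a) (ltW ab) (lexx b)) p).
apply: (le_trans (Ftri _ _ _ (ltW ab) bc)); apply: leeD => //.
apply: (@interval_induction _ (fun s t => F s t <= length g s t gamma)).
- exact: ltW.
- move=> s t u as_ st tu ub Fst Ftu.
  rewrite (@length_cat _ _ s t u); [|by apply: pC => //; lra|by apply: pC => //; lra].
  by apply: (le_trans (Ftri _ _ _ st tu)); exact: leeD.
- by move=> t tab; exact: Floc.
Qed.

Lemma edist_le (g : riemannian_metric M) gamma a b : piecewise_C1 a b gamma ->
  edist g (gamma a) (gamma b) <= length g a b gamma.
Proof. by move=> p; apply: ereal_inf_lbound; exists a, b, gamma; split. Qed.

Lemma edist_lt (g : riemannian_metric M) x y e : edist g x y < e ->
  exists a b gamma, [/\ piecewise_C1 a b gamma, gamma a = x, gamma b = y &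
    length g a b gamma < e].
Proof.
by move=> /ereal_inf_lt[_ [a [b [gamma [p ax yb ->]]]] L]; exists a, b, gamma.
Qed.

Lemma edist_ge0 (g : riemannian_metric M) x y : 0 <= edist g x y.
Proof.
by apply: le_ereal_inf_tmp => _ [a [b [gamma [_ _ _ ->]]]]; exact: length_ge0.
Qed.

Lemma edist_refl (g : riemannian_metric M) x : edist g x x = 0.
Proof.
apply/eqP; rewrite eq_le edist_ge0 andbT.
rewrite -(length_pt g (fun=> x) 0); apply: edist_le; exact: piecewise_C1_refl.
Qed.

(** A nearly optimal curve from x to gamma a, shifted in time so as to end at
    time a, can be followed by gamma. *)
Lemma edist_triangle_curve (g : riemannian_metric M) x a b gamma :
  piecewise_C1 a b gamma ->
  edist g x (gamma b) <= edist g x (gamma a) + length g a b gamma.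
Proof.
move=> p; have [->|] := eqVneq (edist g x (gamma a)) +oo.
  by rewrite addye ?leey// gt_eqF// (lt_le_trans _ (length_ge0 _ _ _ _)).
rewrite -ltey => fin; apply/lee_addgt0Pr => e e0.
have [|c [d [beta [q cx da L]]]] := @edist_lt g x (gamma a) (edist g x (gamma a) + e%:E).
  by rewrite lteDl// ge0_fin_numE//; exact: edist_ge0.
pose a' := (c - (d - a))%R.
have [beta' [q' Lq ax ad]] : exists beta', [/\ piecewise_C1 a' a beta',
    length g a' a beta' = length g c d beta, beta' a' = x & beta' a = gamma a].
  have da' : (d - (d - a) = a)%R by rewrite subKr.
  exists (fun s => beta (s + (d - a))%R); split.
  - by have := piecewise_C1_shift (d - a) q; rewrite da'.
  - by rewrite -(length_shift g (d - a) q) da'.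
  - by rewrite /a' subrK.
  - by rewrite subrKC.
have [eta [E1 E2]] : exists eta, (forall t, (a' <= t <= a)%R -> beta' t = eta t) /\
    (forall t, (a <= t <= b)%R -> gamma t = eta t).
  exists (fun s => if (s <= a)%R then beta' s else gamma s).
  split=> t /andP[at_ ta]; first by rewrite ta.
  have [ta'|//] := leP t a.
  by have -> : t = a by apply/eqP; rewrite eq_le ta'.
have ab := piecewise_C1_le p; have ca := piecewise_C1_le q'.
have Ea : x = eta a' by rewrite -ax; apply: E1; rewrite lexx.
have Eb : gamma b = eta b by apply: E2; rewrite lexx andbT.
rewrite Ea Eb; apply: (le_trans (edist_le g
  (piecewise_C1_cat (piecewise_C1_ext E1 q') (piecewise_C1_ext E2 p)))).
rewrite (length_cat g (piecewise_C1_ext E1 q') (piecewise_C1_ext E2 p)).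
rewrite -(length_ext g E1 q') -(length_ext g E2 p) Lq -Ea.
move: (length g a b gamma) (length g c d beta) L => A B L.
by rewrite addeAC; apply: leeD2r; exact: ltW.
Qed.

Lemma edist_triangle (g : riemannian_metric M) x y z :
  edist g x z <= edist g x y + edist g y z.
Proof.
have [->|] := eqVneq (edist g y z) +oo.
  by rewrite addey ?leey// gt_eqF// (lt_le_trans _ (edist_ge0 _ _ _)).
rewrite -ltey => fin; apply/lee_addgt0Pr => e e0.
have [|a [b [gamma [p ay bz L]]]] := @edist_lt g y z (edist g y z + e%:E).
  by rewrite lteDl// ge0_fin_numE//; exact: edist_ge0.
rewrite -bz -{1}ay; apply: (le_trans (edist_triangle_curve g _ p)).
rewrite ay bz; move: (length g a b gamma) L => A L.
by rewrite -addeA; apply: leeD2l; exact: ltW.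
Qed.

End curves.

(** * Comparison with the coordinate norm *)

Section norm_equivalence.
Context (R : realType) (n : nat).

Lemma mx_entry_le (m p : nat) (A : 'M[R]_(m, p)) i j : `|A i j| <= `|A|.
Proof.
rewrite [leRHS]/Num.Def.normr/= mx_normrE.
exact: (le_bigmax _ (fun ij => `|A ij.1 ij.2|) (i, j)).
Qed.

Lemma qform_le (G : 'M[R]_n) (w : 'rV[R]_n) :
  `|qform G w| <= (n * n)%:R * `|G| * `|w| ^+ 2.
Proof.
rewrite qformE; apply: (le_trans (ler_norm_sum _ _ _)).
have H (j : 'I_n) : true ->
    `|(\sum_(i < n) w 0 i * G i j) * w 0 j| <= n%:R * `|G| * `|w| ^+ 2.
  move=> _; rewrite normrM.
  have : `|\sum_(i < n) w 0 i * G i j| <= n%:R * `|G| * `|w|.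
    apply: (le_trans (ler_norm_sum _ _ _)).
    have H i : true -> `|w 0 i * G i j| <= `|w| * `|G|.
      by move=> _; rewrite normrM ler_pM// mx_entry_le.
    apply: (le_trans (ler_sum _ H)).
    by rewrite sumr_const card_ord -[leLHS]mulr_natl [`|w| * _]mulrC mulrA.
  by move=> h; rewrite expr2 mulrA; apply: ler_pM => //; exact: mx_entry_le.
apply: (le_trans (ler_sum _ H)).
by rewrite sumr_const card_ord -[leLHS]mulr_natl natrM !mulrA.
Qed.

Lemma qformZ (G : 'M[R]_n) a (w : 'rV[R]_n) :
  qform G (a *: w) = a ^+ 2 * qform G w.
Proof.
rewrite /qform linearZ/= -scalemxAl -scalemxAr -scalemxAl scalerA mxE.
by rewrite expr2.
Qed.

Lemma qformB (G G' : 'M[R]_n) (w : 'rV[R]_n) :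
  qform (G - G') w = qform G w - qform G' w.
Proof. by rewrite /qform mulmxBr mulmxBl !mxE. Qed.

(** By homogeneity the constant is the minimum of the form on the unit sphere,
    which is compact. *)
Lemma posdef_lower_bound (G : 'M[R]_n) :
  (forall u : 'rV[R]_n, u != 0 -> 0 < qform G u) ->
  exists2 m, 0 < m & forall w : 'rV[R]_n, m * `|w| ^+ 2 <= qform G w.
Proof.
move=> Gpos; pose S := [set w : 'rV[R]_n | `|w| = 1].
have cS : compact S.
  apply: bounded_closed_compact.
    by exists 1; split => // x x1 w /= ->; exact: ltW.
  have -> : S = (fun w : 'rV[R]_n => `|w|) @^-1` [set 1] by [].
  apply: preimage_closed; last exact: closed_eq.
  by move=> w _; exact: norm_continuous.
have cq : continuous (qform G : 'rV[R]_n -> R).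
  move=> w; apply: (@cvg_qform R n _ (nbhs w) _ (fun=> G) id); last exact: cvg_id.
  exact: cvg_cst.
have [S0|S0] := pselect (S !=set0); last first.
  (* In dimension 0 the sphere is empty and any constant works. *)
  exists 1 => // w; have -> : w = 0.
    apply: contrapT => /eqP w0; apply: S0; exists (`|w|^-1 *: w).
    by rewrite /S/= normrZ normfV normr_id mulVf// normr_eq0.
  by rewrite normr0 expr0n/= mulr0 /qform !mul0mx mxE.
have [u uS umin] := @EVT_min_rV R n (qform G) S S0 cS (continuous_subspaceT cq).
exists (qform G u).
  apply: Gpos; apply/eqP => u0; move: uS; rewrite inE /S/= u0 normr0.
  by move/esym/eqP; rewrite oner_eq0.
move=> w; have [->|w0] := eqVneq w 0.
  by rewrite normr0 expr0n/= mulr0 /qform !mul0mx mxE.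
have nw0 : `|w| != 0 by rewrite normr_eq0.
have -> : qform G w = `|w| ^+ 2 * qform G (`|w|^-1 *: w).
  by rewrite qformZ exprVn mulrA mulfV ?mul1r// expf_eq0.
rewrite mulrC ler_wpM2l ?sqr_ge0//; apply: umin.
by rewrite inE /S/= normrZ normfV normr_id mulVf.
Qed.

End norm_equivalence.

Section local_comparison.
Context (R : realType) (n : nat) (M : manifold R n).
Implicit Types (i j : index M) (x y : M).

Lemma coord_normE (g : riemannian_metric M) i x u :
  coord_norm g i x u = Num.sqrt (qform (gram g i x) u).
Proof. by []. Qed.

(** At the centre this is the compactness of the unit sphere; nearby, the Gram
    matrix moves by less than what the lower constant can absorb. *)
Lemma coord_norm_bounds (g : riemannian_metric M) i x : dom (atlas i) x ->
  exists c C, [/\ 0 < c, 0 < C &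
    \forall q \near coord (atlas i) x, cod (atlas i) q /\
      forall w : 'rV[R]_n, c * `|w| <= coord_norm g i (param (atlas i) q) w /\
        coord_norm g i (param (atlas i) q) w <= C * `|w| ].
Proof.
move=> xi; set p := coord (atlas i) x.
have pi : cod (atlas i) p by exact: coord_cod.
set G := fun q => gram g i (param (atlas i) q).
have [m m0 Gm] : exists2 m, 0 < m & forall w, m * `|w| ^+ 2 <= qform (G p) w.
  apply: posdef_lower_bound => u u0; rewrite /G /p coordK//.
  exact: gram_posdef.
have N0 : 0 < ((n * n)%:R + 1 : R) by rewrite ltr_wpDl.
pose K := (n * n)%:R * (`|G p| + 1) + 1 : R.
have K0 : 0 < K by rewrite ltr_wpDl// mulr_ge0// addr_ge0.
exists (Num.sqrt (m / 2)), (Num.sqrt K); split.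
- by rewrite sqrtr_gt0; lra.
- by rewrite sqrtr_gt0.
near=> q; split; first by near: q; exact: near_cod.
have Gq : `|G p - G q| < Num.min 1 (m / 2 / ((n * n)%:R + 1)).
  near: q; have := @gram_cvg R n M g i p pi; move/cvgrPdist_lt; apply.
  by rewrite lt_min ltr01/= divr_gt0//; lra.
move: Gq; rewrite lt_min ltr_pdivlMr// => /andP[Gq1 Gqm] w.
rewrite coord_normE -/(G q).
have sw : `|w| = Num.sqrt (`|w| ^+ 2) by rewrite sqrtr_sqr normr_id.
have w2 : 0 <= `|w| ^+ 2 by exact: sqr_ge0.
rewrite sw -!sqrtrM; [|exact: ltW|lra]; split; apply: ler_wsqrtr.
  have : qform (G p - G q) w <= m / 2 * `|w| ^+ 2.
    apply: (le_trans (ler_norm _)); apply: (le_trans (qform_le _ _)).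
    apply: ler_wpM2r => //.
    have := normr_ge0 (G p - G q); lra.
  by rewrite qformB; have := Gm w; lra.
apply: (le_trans (ler_norm _)); apply: (le_trans (qform_le _ _)).
apply: ler_wpM2r => //.
have : `|G q| <= `|G p| + 1.
  have -> : G q = G p - (G p - G q) by rewrite opprB addrC subrK.
  by apply: (le_trans (ler_normB _ _)); lra.
move=> h; apply: (@le_trans _ _ ((n * n)%:R * (`|G p| + 1))).
  by apply: ler_wpM2l.
by rewrite lerDl.
Unshelve. all: by end_near. Qed.

(** The sup norm of the displacement is the variation of one coordinate, that is
    the integral of the derivative of this coordinate along the curve. *)
Lemma displacement_le (g : riemannian_metric M) i gamma s t c :
  s <= t -> 0 < c -> C1_segment s t gamma ->
  (forall u, s <= u <= t -> dom (atlas i) (gamma u) /\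
     forall w : 'rV[R]_n, c * `|w| <= coord_norm g i (gamma u) w) ->
  ((c * `|coord (atlas i) (gamma t) - coord (atlas i) (gamma s)|)%:E
    <= length g s t gamma)%E.
Proof.
move=> st c0 Cst H.
move: st; rewrite le_eqVlt => /predU1P[<-|st].
  by rewrite subrr normr0 mulr0 length_pt.
set v := coord _ _ - _.
(* k is the coordinate that realizes the sup norm of the displacement. *)
have [v0|/mx_norm_neq0[[a k] /= vk]] := eqVneq (mx_norm v) 0.
  have -> : `|v| = 0 by exact: v0.
  by rewrite mulr0 length_ge0.
have {}vk : `|v| = `|v 0 k| by rewrite -(ord1 a); exact: vk.
have [e [delta [e0 C D]]] := Cst.
have stE u : u \in `]s, t[ -> s <= u <= t.
  by rewrite in_itv/= => /andP[? ?]; rewrite !ltW.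
have H' u : s <= u <= t -> dom (atlas i) (delta u).
  by move=> su; rewrite D//; have [] := H u su.
have C' u : s <= u <= t -> C1_at delta u.
  by move=> /andP[? ?]; apply: C; apply/andP; split; lra.
pose f u := coord (atlas i) (delta u) 0 k.
pose f' u := derive1 (coord (atlas i) \o delta) u 0 k.
have cf' u : s <= u <= t -> {for u, continuous f'}.
  move=> su; have [_ /(_ i (H' u su))[_ c']] := C' u su.
  apply: (cvg_comp _ (fun N : 'rV[R]_n => N 0 k) c'); exact: coord_continuous.
have df u : s <= u <= t -> is_derive u 1 f (f' u).
  move=> su; have [_ /(_ i (H' u su))[d _]] := C' u su.
  apply: DeriveDef; first by have /derivable_mxP := d; exact.
  by rewrite /f' derive1E derive_mx// mxE.
have cf u : s <= u <= t -> {for u, continuous f}.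
  move=> su; apply: differentiable_continuous; apply/derivable1_diffP.
  by have [] := df u su.
have cf'w : {within `[s, t], continuous f'}.
  apply: continuous_in_subspaceT => u; rewrite inE/= in_itv/=; exact: cf'.
have mf' : measurable_fun `[s, t] f'.
  by apply: subspace_continuous_measurable_fun.
have E : (\int[lebesgue_measure]_(u in `[s, t]) (f' u)%:E = (f t)%:E - (f s)%:E)%E.
  apply: continuous_FTC2 => //.
  - split.
    + by move=> u /stE su; have [] := df u su.
    + by apply: cvg_at_right_filter; apply: cf; rewrite lexx ltW.
    + by apply: cvg_at_left_filter; apply: cf; rewrite lexx ltW.
  - by move=> u /stE su; rewrite derive1E; have [_ ->] := df u su.
have pst : piecewise_C1 s t gamma by apply: piecewise_C1_segment => //; exact: ltW.
rewrite EFinM; have -> : `|v|%:E = (`|\int[lebesgue_measure]_(u in `[s, t]) (f' u)%:E|)%E.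
  rewrite E -EFinB abse_EFin vk; congr (`| _ |%:E).
  by rewrite /v /f !D ?lexx ?ltW// !mxE.
apply: (@le_trans _ _ (c%:E * \int[lebesgue_measure]_(u in `[s, t]) (`|f' u|)%:E)%E).
  apply: lee_wpmul2l; first by rewrite lee_fin ltW.
  by apply: le_abse_integral => //; exact/measurable_EFinP.
have mf'' : measurable_fun `[s, t] (fun u => `|f' u|) by exact: measurableT_comp.
rewrite -(integral_itvZl (f := fun u => `|f' u|) (ltW c0))//.
rewrite /length; apply: (@le_integral_itv _ (fun u => c * `|f' u|) (speed g gamma)).
- exact: measurable_funM.
- exact: measurable_speed.
- by move=> u; rewrite mulr_ge0// ltW.
- move=> u /andP[su ut].
  have su' : s <= u <= t by rewrite !ltW.
  have [di hu] := H u su'.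
  have -> : speed g gamma u = speed g delta u.
    apply: speed_near; near=> z; apply/esym/D.
    by apply: stE; near: z; apply: near_in_itvoo; rewrite in_itv/= su.
  rewrite (@speedE _ _ _ g delta u i (C' u su') (H' u su')) D//.
  apply: le_trans (hu _); apply: ler_wpM2l; first exact: ltW.
  exact: (mx_entry_le (derive1 (coord (atlas i) \o delta) u)).
Unshelve. all: by end_near. Qed.

End local_comparison.

(** * A Riemannian distance induces the topology *)

Section topology_comparison.
Context (R : realType) (n : nat) (M : manifold R n).
Implicit Types (i j : index M) (x y : M).

Lemma derive1_line (W : normedModType R) (f : 'rV[R]_n -> W) (q w : 'rV[R]_n) :
  derive1 (fun t : R => f (q + t *: w)) = (fun t => 'D_w f (q + t *: w)).
Proof.
apply/funext => t; rewrite /derive1 /derive.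
set F := fun h : R => _ *: _; set G := fun h : R => _ *: _.
suff -> : F = G by [].
apply/funext => h; rewrite /F /G /=; congr (_ *: (f _ - _)).
by rewrite scalerDl addrCA.
Qed.

Lemma derivable_line (W : normedModType R) (f : 'rV[R]_n -> W) (q w : 'rV[R]_n) t :
  derivable f (q + t *: w) w -> derivable (fun t : R => f (q + t *: w)) t 1.
Proof.
rewrite /derivable.
set F := fun h : R => _ *: _; set G := fun h : R => _ *: _.
suff -> : F = G by [].
apply/funext => h; rewrite /F /G /=; congr (_ *: (f _ - _)).
by rewrite [h%:A]mulr1 scalerDl addrCA.
Qed.

Lemma continuous_line (q w : 'rV[R]_n) : continuous (fun t : R => q + t *: w).
Proof.
move=> t; apply: cvgD; first exact: cvg_cst.
by apply: cvgZr_tmp; exact: cvg_id.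
Qed.

Lemma C1_at_line i (q w : 'rV[R]_n) t : cod (atlas i) (q + t *: w) ->
  C1_at (fun s => param (atlas i) (q + s *: w)) t.
Proof.
move=> ct; split.
  apply: (@continuous_comp _ _ _ (fun s : R => q + s *: w) (param (atlas i))).
    exact: continuous_line.
  exact: param_continuous_cod.
move=> j tj; have [dT cT] := transition_C1 i j.
have U : (cod (atlas i) `&` param (atlas i) @^-1` dom (atlas j)) (q + t *: w) by [].
split.
  apply: (@derivable_line _ (transition (atlas i) (atlas j))).
  by apply: diff_derivable; exact: dT.
have -> : derive1 (coord (atlas j) \o (fun s => param (atlas i) (q + s *: w))) =
    (fun s => 'D_w (transition (atlas i) (atlas j)) (q + s *: w)).
  exact: (@derive1_line _ (transition (atlas i) (atlas j))).
apply: (@continuous_comp _ _ _ (fun s : R => q + s *: w)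
  ('D_w (transition (atlas i) (atlas j)))); first exact: continuous_line.
exact: cT.
Qed.

Lemma speed_line (g : riemannian_metric M) i (q w : 'rV[R]_n) t :
  cod (atlas i) (q + t *: w) ->
  speed g (fun s => param (atlas i) (q + s *: w)) t =
  coord_norm g i (param (atlas i) (q + t *: w)) w.
Proof.
move=> ct; set delta := fun s => param _ _.
have di : dom (atlas i) (delta t) by exact: param_dom.
rewrite (@speedE _ _ _ g delta t i (C1_at_line ct) di); congr coord_norm.
have -> : derive1 (coord (atlas i) \o delta) =
    (fun s => 'D_w (transition (atlas i) (atlas i)) (q + s *: w)).
  exact: (@derive1_line _ (transition (atlas i) (atlas i))).
have := mul_jac w di di; rewrite /delta paramK// => <-.
by rewrite jac_same ?mulmx1.
Qed.

(** The length of a straight segment of a chart.  A curve that is C^1 on the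
    closed interval [0, 1] has to be C^1 on an open one around it, whence the
    bounds -1 and 2. *)
Lemma edist_line (g : riemannian_metric M) i (q w : 'rV[R]_n) C :
  (forall t, -1 < t < 2 -> cod (atlas i) (q + t *: w) /\
     coord_norm g i (param (atlas i) (q + t *: w)) w <= C) ->
  (edist g (param (atlas i) q) (param (atlas i) (q + w)) <= C%:E)%E.
Proof.
move=> H; pose delta s := param (atlas i) (q + s *: w).
have p : piecewise_C1 0 1 delta.
  apply: piecewise_C1_segment => //; exists 1, delta; split => // t /andP[? ?].
  by apply: C1_at_line; apply: (proj1 (H t _)); apply/andP; split; lra.
have := edist_le g p; rewrite /delta scale0r addr0 scale1r => /le_trans; apply.
have -> : C%:E = (\int[lebesgue_measure]_(t in `[0%R, 1%R]) C%:E)%E.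
  by rewrite integral_itv_cst// subr0 mulr1.
rewrite /length; apply: (@le_integral_itv _ (speed g delta) (fun=> C)) => //.
- exact: measurable_speed.
- by move=> t; exact: speed_ge0.
- move=> t /andP[t0 t1]; have [|ct cC] := H t; first by apply/andP; split; lra.
  by rewrite /delta speed_line.
Qed.

(** Straight segments of a chart around x, run from x to y and from y to x, have
    a length proportional to their coordinate length. *)
Lemma near_edist (g : riemannian_metric M) x e : 0 < e ->
  \forall y \near x, (edist g x y < e%:E)%E /\ (edist g y x < e%:E)%E.
Proof.
move=> e0; pose i := chart_at x; have xi : dom (atlas i) x by exact: chart_atP.
have [c [C [c0 C0 /nbhs_normP[r /= r0 B]]]] := coord_norm_bounds g xi.
pose p := coord (atlas i) x; rewrite -/p in B.
near=> y.
have yi : dom (atlas i) y by near: y; exact: near_dom.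
pose w := coord (atlas i) y - p.
have : `|p - coord (atlas i) y| < Num.min (r / 2) (e / 2 / C).
  near: y; have := @coord_continuous_dom _ _ _ (atlas i) x xi.
  by move/cvgrPdist_lt; apply; rewrite lt_min !divr_gt0.
rewrite distrC -/w lt_min (ltr_pdivlMr _ _ C0) => /andP[wr we].
have Hw t : -1 < t < 2 -> `|t *: w| < r.
  move=> /andP[t1 t2]; rewrite normrZ.
  apply: (@le_lt_trans _ _ (2 * `|w|)); last lra.
  by apply: ler_wpM2r => //; rewrite ler_norml; apply/andP; split; lra.
have lt_e : ((C * `|w|)%:E < e%:E)%E by rewrite lte_fin mulrC; lra.
split; apply: le_lt_trans lt_e.
  rewrite -[in edist _ x _](coordK xi) -/p -(coordK yi).
  have -> : coord (atlas i) y = p + w by rewrite /w addrC subrK.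
  apply: edist_line => t /Hw tr.
  have [|? H] := B (p + t *: w); first by rewrite /= opprD addNKr normrN.
  by split => //; have [] := H w.
rewrite -[in edist _ _ x](coordK xi) -/p -(coordK yi).
rewrite [X in edist _ _ (param _ X)](_ : _ = coord (atlas i) y + - w); last first.
  by rewrite /w opprB addrC subrK.
apply: edist_line => t /andP[t0 t1].
have -> : coord (atlas i) y + t *: - w = p + (1 - t) *: w.
  by rewrite scalerN scalerBl scale1r /w addrA [p + _]addrC subrK.
have tr : `|(1 - t) *: w| < r by apply: Hw; apply/andP; split; lra.
have [|? H] := B (p + (1 - t) *: w); first by rewrite /= opprD addNKr normrN.
by split => //; have [_] := H (- w); rewrite normrN.
Unshelve. all: by end_near. Qed.

(** Let rad be the coordinate distance to x, cut off at the value rho outside the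
    compact coordinate ball K of radius rho.  Along any curve a variation of rad
    costs at least c times as much length: inside a slightly larger coordinate
    ball by the lower bound on the metric, and outside K because rad is constant.
    A curve from a point outside K to x therefore has length at least c rho. *)
Lemma edist_nbhs (g : riemannian_metric M) x (N : set M) : nbhs x N ->
  exists2 e, 0 < e & forall y, (edist g y x < e%:E)%E -> N y.
Proof.
move=> xN; pose i := chart_at x; have xi : dom (atlas i) x by exact: chart_atP.
have [c [C [c0 C0 B]]] := coord_norm_bounds g xi.
pose p := coord (atlas i) x; rewrite -/p in B.
have pN : \forall q \near p, N (param (atlas i) q).
  have := @param_continuous_cod _ _ _ (atlas i) _ (coord_cod xi).
  by apply; rewrite coordK.
have [r /= r0 BN] : nbhs_ball_ (ball_ (@Num.norm R 'rV[R]_n)) p _ :=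
  (proj1 (nbhs_normP _ _) (filterI B pN)).
pose rho := r / 2; have rho0 : 0 < rho by rewrite divr_gt0.
pose K := param (atlas i) @` closed_ball p rho.
have inB q : `|p - q| <= rho -> cod (atlas i) q /\ N (param (atlas i) q).
  by move=> pq; have [|[? _] ?] := BN q => //=; apply: le_lt_trans pq _; rewrite /rho; lra.
(* This is where M has to be Hausdorff: K must have an open complement. *)
have Kcl : closed K.
  apply: compact_closed; first exact: manifold_hausdorff.
  apply: continuous_compact.
    apply: continuous_in_subspaceT => q; rewrite inE closed_ballE// => /inB[? _].
    exact: param_continuous_cod.
  apply: bounded_closed_compact; last exact: closed_ball_closed.
  exists (`|p| + rho); split; first exact: num_real.
  move=> z pz q; rewrite closed_ballE// /closed_ball_/= => pq.
  apply: ltW; apply: le_lt_trans pz.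
  have -> : q = p - (p - q) by rewrite opprB addrC subrK.
  by apply: (le_trans (ler_normB _ _)); rewrite lerD2l.
have KE y : K y -> dom (atlas i) y /\ `|p - coord (atlas i) y| <= rho.
  move=> [q]; rewrite closed_ballE// /closed_ball_/= => pq <-.
  have [cq _] := inB q pq; split; first exact: param_dom.
  by rewrite paramK.
have EK y : dom (atlas i) y -> `|p - coord (atlas i) y| <= rho -> K y.
  move=> yi yp; exists (coord (atlas i) y); last exact: coordK.
  by rewrite closed_ballE.
pose rad y : R := if `[< K y >] then `|p - coord (atlas i) y| else rho.
have radE y : dom (atlas i) y -> rad y = Num.min rho `|p - coord (atlas i) y|.
  move=> yi; rewrite /rad; case: asboolP => [/KE[_ yp]|nK]; first by rewrite min_r.
  by rewrite min_l// leNgt; apply/negP => /ltW /(EK _ yi).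
have radN y : ~ K y -> rad y = rho by move=> nK; rewrite /rad asboolF.
exists (c * rho); first exact: mulr_gt0.
move=> y /edist_lt[a [b [gamma [pw ay bx L]]]].
have : ((c * (rad (gamma a) - rad (gamma b)))%:E <= length g a b gamma)%E.
  pose F s t := (c * (rad (gamma s) - rad (gamma t)))%:E.
  apply: (@length_ge _ _ _ g gamma F) => //.
  - by move=> s; rewrite /F subrr mulr0.
  - by move=> s t u _ _; rewrite /F -EFinD lee_fin -mulrDr addrA subrK.
  move=> u v t Cuv tuv.
  have [[ti tr]|] := pselect (dom (atlas i) (gamma t) /\
      `|p - coord (atlas i) (gamma t)| < r).
    have nb : \forall z \near gamma t, dom (atlas i) z /\
        `|p - coord (atlas i) z| < r.
      have E : \forall q \near coord (atlas i) (gamma t), `|p - q| < r.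
        have := @ball_open _ _ p r; rewrite -ball_normE => bo.
        by apply: open_nbhs_nbhs; split.
      near=> z; split; first by near: z; exact: near_dom.
      near: z; exact: (@coord_continuous_dom _ _ _ (atlas i) _ ti _ E).
    have [e e0 H] := C1_segment_near Cuv tuv nb.
    exists e => // s s' us ss' s'v ts s't.
    have H' z : s <= z <= s' -> dom (atlas i) (gamma z) /\
        `|p - coord (atlas i) (gamma z)| < r.
      move=> /andP[? ?]; apply: H; first by apply/andP; split; lra.
      by rewrite ltr_norml; apply/andP; split; lra.
    apply: le_trans (@displacement_le _ _ _ g i gamma s s' c ss' c0 _ _).
    + have [[si _] [si' _]] : (dom (atlas i) (gamma s) /\ `|p - coord (atlas i) (gamma s)| < r)
        /\ (dom (atlas i) (gamma s') /\ `|p - coord (atlas i) (gamma s')| < r).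
        by split; apply: H'; rewrite lexx ss'.
      rewrite /F lee_fin ler_pM2l// !radE//.
      set A := coord _ _; set A' := coord _ _.
      have : `|p - A| <= `|p - A'| + `|A' - A|.
        have -> : p - A = (p - A') + (A' - A) by rewrite addrA subrK.
        exact: ler_normD.
      by rewrite /Num.min; case: ltP => ?; case: ltP => ?; have := normr_ge0 (A' - A); lra.
    + exact: C1_segment_sub Cuv.
    + move=> z /H'[zi zr]; split => // w.
      have [|[_ Hz] _] := BN (coord (atlas i) (gamma z)) => //.
      by have [] := Hz w; rewrite coordK.
  move=> nt; have nK : ~ K (gamma t).
    move=> /KE[ti tr]; apply: nt; split => //; apply: le_lt_trans tr _.
    by rewrite /rho; lra.
  have nb : nbhs (gamma t) (~` K).
    by apply: open_nbhs_nbhs; split => //; exact: closed_openC.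
  have [e e0 H] := C1_segment_near Cuv tuv nb.
  exists e => // s s' us ss' s'v ts s't.
  rewrite /F !radN ?subrr ?mulr0 ?length_ge0//; apply: H.
  - by apply/andP; split; lra.
  - by rewrite ltr_norml; apply/andP; split; lra.
  - by apply/andP; split; lra.
  - by rewrite ltr_norml; apply/andP; split; lra.
move=> /le_lt_trans /(_ L); rewrite lte_fin ltr_pM2l//.
have -> : rad (gamma b) = 0 by rewrite bx radE// subrr normr0 min_r// ltW.
rewrite subr0 ay => yr.
have /KE[yi yp] : K y by apply: contrapT => /radN E; move: yr; rewrite E ltxx.
by rewrite -(coordK yi); have [] := inB _ yp.
Unshelve. all: by end_near. Qed.

End topology_comparison.

(** * The distance function of a connected manifold *)

Section distance_function.
Context (R : realType) (n : nat) (M : manifold R n) (g : riemannian_metric M).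
Hypothesis M_connected : connected [set: M].
Local Open Scope ereal_scope.

(** Points of a small ball are at finite distance from its centre and conversely,
    so the set of points at finite distance from x is open and closed. *)
Lemma edist_lty (x y : M) : edist g x y < +oo.
Proof.
pose S := [set z | edist g x z < +oo].
suff ST : S = [set: M] by have : [set: M] y by []; rewrite -ST.
have So : open S.
  rewrite openE => z /= xz; apply: (filterS _ (near_edist g z (@ltr01 R))).
  move=> w [zw _]; apply: (le_lt_trans (edist_triangle g x z w)).
  by rewrite lte_add_pinfty// (lt_trans zw)// ltry.
have Sc : open (~` S).
  rewrite openE => z /= xz; apply: (filterS _ (near_edist g z (@ltr01 R))).
  move=> w [_ wz] xw; apply: xz; apply: (le_lt_trans (edist_triangle g x w z)).
  by rewrite lte_add_pinfty// (lt_trans wz)// ltry.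
apply: M_connected.
- by exists x; rewrite /S/= edist_refl ltry.
- by exists S => //; rewrite setTI.
- by exists S; rewrite ?setTI//; rewrite -(setCK S); exact: open_closedC.
Qed.

Lemma edist_fin (x y : M) : edist g x y \is a fin_num.
Proof. by rewrite ge0_fin_numE ?edist_ge0// edist_lty. Qed.

Lemma edistE (x y : M) : edist g x y = (dist g x y)%:E.
Proof. by rewrite /dist fineK// edist_fin. Qed.

Lemma dist_ge0 (x y : M) : (0 <= dist g x y)%R.
Proof. by rewrite fine_ge0// edist_ge0. Qed.

Lemma dist_triangle (x y z : M) : (dist g x z <= dist g x y + dist g y z)%R.
Proof. by rewrite -lee_fin EFinD -!edistE edist_triangle. Qed.

Lemma near_dist (x0 x : M) (e : R) : (0 < e)%R ->
  \forall y \near x, (`|dist g x0 y - dist g x0 x| < e)%R.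
Proof.
move=> e0; apply: (filterS _ (near_edist g x e0)) => y [].
rewrite !edistE !lte_fin => xy yx.
have := dist_triangle x0 x y; have := dist_triangle x0 y x => h1 h2.
by rewrite ltr_norml; apply/andP; split; lra.
Qed.

End distance_function.

(** * Completeness from a weight of infinite mass *)

Section completeness.
Context (R : realType) (n : nat) (M : manifold R n).
Context (gR h : riemannian_metric M) (x0 : M) (f : R -> R).
Hypothesis M_connected : connected [set: M].
Hypothesis f_continuous : continuous f.
Hypothesis f_gt0 : forall r, 0 < f r.
Hypothesis f_bound : forall (x : M) (w : 'rV[R]_n),
  coord_norm gR (chart_at x) x w * f (dist gR x0 x)
    <= coord_norm h (chart_at x) x w.

Let d (x : M) : R := dist gR x0 x.

Let f_ge0 r : 0 <= f r. Proof. exact: ltW. Qed.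

Let measurable_f (A : set R) : measurable_fun A f.
Proof. by apply: measurable_funTS; exact: continuous_measurable_fun. Qed.

Lemma speed_weight (gamma : R -> M) t :
  speed gR gamma t * f (d (gamma t)) <= speed h gamma t.
Proof. exact: f_bound. Qed.

Lemma length_weight (gamma : R -> M) (k a b : R) : 0 <= k ->
  piecewise_C1 a b gamma -> (forall t, a <= t <= b -> k <= f (d (gamma t))) ->
  (k%:E * length gR a b gamma <= length h a b gamma)%E.
Proof.
move=> k0 p kf; rewrite /length.
rewrite -(@integral_itvZl _ (speed gR gamma)) //; last 2 first.
- by move=> t; exact: speed_ge0.
- exact: measurable_speed.
apply: (@le_integral_itv _ (fun t => k * speed gR gamma t) (speed h gamma)).
- apply: measurable_funM => //; exact: measurable_speed.
- exact: measurable_speed.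
- by move=> t; rewrite mulr_ge0// speed_ge0.
- move=> t /andP[t1 t2]; apply: le_trans (speed_weight gamma t).
  by rewrite mulrC ler_wpM2l ?speed_ge0// kf// !ltW.
Qed.

Local Open Scope ereal_scope.
Local Notation mu := (@lebesgue_measure R).

Let wint (r s : R) := \int[mu]_(x in `[r, s]) (f x)%:E.

Lemma le_wint (r s r' s' : R) : (r' <= r)%R -> (s <= s')%R ->
  wint r s <= wint r' s'.
Proof.
move=> rr ss; apply: ge0_subset_integral => //=.
- by apply/measurable_EFinP; apply: measurable_f.
- by move=> x _; rewrite lee_fin.
- by move=> x /=; rewrite !in_itv/= => /andP[? ?]; apply/andP; split; lra.
Qed.

Lemma wint_ge0 r s : 0 <= wint r s.
Proof. by apply: integral_ge0 => x _; rewrite lee_fin. Qed.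

(** Whatever the order of r, s and t, the interval [r, t] is covered by [r, s]
    and [s, t], since an interval with exchanged endpoints is empty. *)
Lemma wint_subadd (r s t : R) : wint r t <= wint r s + wint s t.
Proof.
have [rs|sr] := leP r s; last first.
  apply: (@le_trans _ _ (wint s t)); first by apply: le_wint => //; exact: ltW.
  by rewrite leeDr// wint_ge0.
have [st|ts] := leP s t; last first.
  apply: (@le_trans _ _ (wint r s)); first by apply: le_wint => //; exact: ltW.
  by rewrite leeDl// wint_ge0.
by rewrite /wint (integral_itv_cat rs st)//; exact: measurable_f.
Qed.

(** Near a time t, f(d(gamma)) lies between 2k/3 and 4k/3, with k its value at t.
    So the integral is at most 4k/3 times the variation of d, hence 4k/3 times
    the gR-length, while the h-length is at least 2k/3 times the gR-length. *)
Lemma wint_le_length (gamma : R -> M) (a b : R) : piecewise_C1 a b gamma ->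
  wint (d (gamma a)) (d (gamma b)) <= 2%:E * length h a b gamma.
Proof.
move=> p.
suff : (2^-1)%:E * wint (d (gamma a)) (d (gamma b)) <= length h a b gamma.
  move=> /(lee_wpmul2l (x := 2%:E)) H; apply: le_trans (H _) => //.
  by rewrite muleA -EFinM divff// mul1e.
apply: (@length_ge _ _ _ h gamma
  (fun s t => (2^-1)%:E * wint (d (gamma s)) (d (gamma t)))) => //.
- by move=> s; rewrite /wint integral_itv_pt mule0.
- move=> s t u _ _; rewrite -ge0_muleDr ?wint_ge0//.
  by apply: lee_wpmul2l; [rewrite lee_fin|exact: wint_subadd].
move=> u v t C tuv; set k := f (d (gamma t)).
have k0 : (0 < k)%R by exact: f_gt0.
have [eta eta0 Hf] : exists2 eta, (0 < eta)%R &
    forall r, (`|r - d (gamma t)| < eta)%R -> (`|f r - k| < k / 3)%R.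
  have fc : {for d (gamma t), continuous f} by exact: f_continuous.
  have k3 : (0 < k / 3)%R by rewrite divr_gt0.
  have [eta /= eta0 B] := proj1 (nbhs_ballP (d (gamma t)) _)
    (proj1 (cvgrPdist_lt _ _) fc _ k3).
  exists eta => // r rt; rewrite distrC; apply: B.
  by rewrite /ball/= distrC.
have nb : \forall z \near gamma t, (`|d z - d (gamma t)| < eta)%R.
  exact: near_dist.
have [e e0 H] := C1_segment_near C tuv nb.
exists e => // s s' us ss' s'v ts s't.
have H' z : (s <= z <= s')%R -> (`|d (gamma z) - d (gamma t)| < eta)%R.
  move=> /andP[? ?]; apply: H; first by apply/andP; split; lra.
  by rewrite ltr_norml; apply/andP; split; lra.
have ps : piecewise_C1 s s' gamma.
  by apply: piecewise_C1_segment => //; exact: C1_segment_sub C.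
have [ds|ds] := leP (d (gamma s)) (d (gamma s')); last first.
  rewrite /wint set_itv_ge ?bnd_simp -?ltNge//.
  by rewrite integral_set0 mule0 length_ge0.
have : (`|d (gamma s) - d (gamma t)| < eta)%R by apply: H'; rewrite lexx ss'.
have : (`|d (gamma s') - d (gamma t)| < eta)%R by apply: H'; rewrite lexx ss'.
rewrite !ltr_norml => /andP[? ?] /andP[? ?].
apply: (@le_trans _ _ ((2 * k / 3)%:E * length gR s s' gamma)).
  apply: (@le_trans _ _ ((2 * k / 3)%:E * (d (gamma s') - d (gamma s))%:E)).
    rewrite -EFinM (_ : 2 * k / 3 * (d (gamma s') - d (gamma s)) =
      2^-1 * (4 * k / 3 * (d (gamma s') - d (gamma s))))%R; last by field.
    rewrite EFinM; apply: lee_wpmul2l; first by rewrite lee_fin.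
    rewrite -integral_itv_cst//.
    apply: (@le_integral_itv _ f (fun=> 4 * k / 3)%R) => //.
    move=> r /andP[r1 r2]; have : (`|f r - k| < k / 3)%R.
      by apply: Hf; rewrite ltr_norml; apply/andP; split; lra.
    by rewrite ltr_norml => /andP[? ?]; lra.
  apply: lee_wpmul2l; first by rewrite lee_fin; lra.
  rewrite EFinB leeBlDl//.
  have := edist_triangle_curve gR x0 ps.
  by rewrite !edistE.
apply: length_weight => //; first lra.
move=> z /H' /Hf; rewrite ltr_norml => /andP[? ?]; lra.
Qed.

Hypothesis f_integral : \int[mu]_(r in `[0%R, +oo[) (f r)%:E = +oo.

(** If d exceeded K at a point of the h-ball, a curve to this point would have
    to gather the mass of [d x, K], which exceeds 2 B, while its h-length is less
    than B. *)
Lemma ball_dist_bounded (x : M) (B : R) : (0 <= B)%R ->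
  exists2 K, (0 <= K)%R & forall y, edist h x y < B%:E -> (d y <= K)%R.
Proof.
move=> B0.
have d0 : (0 <= d x)%R by exact: dist_ge0.
have [K xK BK] := integral_unbounded (2 * B)%R f_ge0 f_continuous f_integral d0.
exists K => [|y /edist_lt[a [b [gamma [p ax yb L]]]]]; first exact: le_trans xK.
rewrite leNgt; apply/negP => Ky.
have : (2 * B)%:E < 2%:E * B%:E.
  apply: (lt_le_trans BK); apply: (@le_trans _ _ (wint (d x) (d y))).
    by apply: le_wint => //; exact: ltW.
  rewrite -ax -yb; apply: (le_trans (wint_le_length p)).
  by apply: lee_wpmul2l => //; exact: ltW.
by rewrite EFinM ltxx.
Qed.

(** A tail of an h-Cauchy sequence u, and the short h-curves joining its terms,
    lie in the h-ball of radius 2 around one of its terms.  There d <= K, so f(d)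
    is at least its minimum f c on [0, K] and h-length dominates f c times
    gR-length: u is gR-Cauchy. *)
Lemma complete_of_weight : complete_metric gR -> complete_metric h.
Proof.
move=> gR_complete u cu.
have [N0 HN0] := cu 1%R ltr01.
have [K K0 HK] := @ball_dist_bounded (u N0) 2 (ler0n _ 2).
have [|c _ fc] := @EVT_min R f 0%R K K0; first exact: continuous_subspaceT.
have [x ux] : exists x, converges_to gR u x.
  apply: gR_complete => e e0.
  have m0 : (0 < Num.min 1 (f c * e))%R by rewrite lt_min ltr01 mulr_gt0.
  have [N1 HN1] := cu _ m0.
  exists (maxn N0 N1) => p q; rewrite !geq_max => /andP[p0 p1] /andP[q0 q1].
  have /edist_lt[a [b [gamma [pw ap bq L]]]] := HN1 p q p1 q1.
  have [L1 Le] : length h a b gamma < 1%:E /\ length h a b gamma < (f c * e)%:E.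
    by split; apply: (lt_le_trans L); rewrite lee_fin ge_min lexx ?orbT.
  have W : (f c)%:E * length gR a b gamma <= length h a b gamma.
    apply: length_weight => // t atb; apply: fc.
    rewrite in_itv/= dist_ge0//=; apply: HK.
    have pt := piecewise_C1_prefix pw atb.
    apply: (le_lt_trans (edist_triangle_curve h _ pt)).
    have -> : 2%:E = 1%:E + 1%:E :> \bar R by rewrite -EFinD.
    apply: lteD; first by rewrite ap; exact: HN0.
    apply: le_lt_trans L1; apply: ge0_subset_integral => //=.
    - by apply/measurable_EFinP; exact: measurable_speed.
    - by move=> z _; rewrite lee_fin speed_ge0.
    - move: atb => /andP[_ tb] z /=; rewrite !in_itv/= => /andP[-> zt].
      exact: le_trans tb.
  rewrite -ap -bq; apply: (le_lt_trans (edist_le gR pw)).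
  by rewrite -(@lte_pmul2l _ (f c)%:E) ?lte_fin//; exact: le_lt_trans Le.
exists x => e e0.
have [e' e'0 He'] := edist_nbhs gR (near_edist h x e0).
have [N HN] := ux e' e'0.
by exists N => p /HN /He'[].
Qed.

End completeness.

(** * Locally Lipschitz and affine profiles *)

Section profile.
Context (R : realType).

(** At r the hypothesis is used around the diagonal point (r', r') with
    r' = max r 0: there phi is Lipschitz on nonnegative numbers. *)
Lemma inv_profile_continuous (phi : R -> R) : positive_loc_lipschitz phi ->
  continuous (fun r : R => (phi (Num.max r 0))^-1).
Proof.
move=> [phi0 phiL] r.
set r' := Num.max r 0.
have r'0 : 0 <= r' by rewrite le_max lexx orbT.
have max_cont : (fun s : R => Num.max s 0) @ r --> r'.
  by apply: continuous_max; [exact: cvg_id|exact: cvg_cst].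
apply: cvgV; first by rewrite gt_eqF// phi0.
have A : (`[0, +oo[%classic `*` `[0, +oo[%classic) (r', r').
  by split; rewrite /= in_itv/= r'0.
have := phiL (r', r') A; rewrite /lipschitz_on.
move=> /pinfty_ex_gt0[L L0 [[U V] /= [rU rV] HL]].
apply/cvgrPdist_lt => e e0; near=> s.
have s0 : 0 <= Num.max s 0 by rewrite le_max lexx orbT.
have As : (`[0, +oo[%classic `*` `[0, +oo[%classic) (r', Num.max s 0).
  by split; rewrite /= in_itv/= ?r'0 ?s0.
have Ls : `|phi r' - phi (Num.max s 0)| <= L * `|r' - Num.max s 0|.
  apply: (HL (r', Num.max s 0)) => //; split; first exact: nbhs_singleton.
  by near: s; exact: max_cont.
apply: (le_lt_trans Ls); rewrite mulrC -ltr_pdivlMr//.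
by near: s; move/cvgrPdist_lt: max_cont; apply; rewrite divr_gt0.
Unshelve. all: by end_near. Qed.

End profile.


Theorem proposition3p1 (R : realType) (n : nat) (M : manifold R n)
    (gR : riemannian_metric M) (x0 : M)
    (M_connected : connected [set: M]) (gR_complete : complete_metric gR) :
  (forall (phi : R -> R) (h : riemannian_metric M),
     positive_loc_lipschitz phi ->
     inv_integral_infinite phi ->
     norm_bound gR h x0 phi ->
     complete_metric h)
  /\
  (forall (phi : R -> R) (a b : R),
     positive_loc_lipschitz phi ->
     0 <= a -> 0 <= b ->
     (forall r, 0 <= r -> phi r <= a + b * r) ->
     [/\ 0 < a,
         inv_integral_infinite phi &
         forall h : riemannian_metric M, norm_bound gR h x0 phi ->
           norm_bound gR h x0 (fun r => a + b * r) /\ complete_metric h])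
  /\
  (forall (a b : R) (h : riemannian_metric M),
     0 < a -> 0 <= b ->
     norm_bound gR h x0 (fun r => a + b * r) ->
     complete_metric h).
Proof.
have eq_max (psi : R -> R) r : 0 <= r -> psi (Num.max r 0) = psi r.
  by move=> r0; rewrite max_l.
have complete phi h : positive_loc_lipschitz phi -> inv_integral_infinite phi ->
    norm_bound gR h x0 phi -> complete_metric h.
  move=> phiP phiI nb.
  apply: (@complete_of_weight R n M gR h x0 (fun r : R => (phi (Num.max r 0))^-1)) => //.
  - exact: inv_profile_continuous.
  - by move=> r; rewrite invr_gt0; apply: (proj1 phiP); rewrite le_max lexx orbT.
  - move=> x w; rewrite eq_max ?dist_ge0//; exact: norm_bound_coord.
  - rewrite -[RHS]phiI; apply: eq_integral => r; rewrite inE/= in_itv/= andbT => r0.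
    by rewrite eq_max.
split; first exact: complete.
split=> [phi a b phiP a0 b0 phi_le|a b h a0 b0 nb].
  have phi0 := proj1 phiP.
  have a_gt0 : 0 < a.
    by have := phi_le 0 (lexx 0); rewrite mulr0 addr0; apply: lt_le_trans; exact: phi0.
  have phiI : inv_integral_infinite phi.
    apply/eqP; rewrite -leye_eq -(integral_inv_affine a_gt0 b0).
    rewrite [leRHS](_ : _ = \int[lebesgue_measure]_(r in `[0%R, +oo[)
      ((phi (Num.max r 0))^-1)%:E)%E; last first.
      apply: eq_integral => r; rewrite inE/= in_itv/= andbT => r0.
      by rewrite eq_max.
    rewrite [leLHS](_ : _ = \int[lebesgue_measure]_(r in `[0%R, +oo[)
      ((a + b * Num.max r 0)^-1)%:E)%E; last first.
      apply: eq_integral => r; rewrite inE/= in_itv/= andbT => r0.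
      by rewrite max_l.
    have c0 r : 0 <= Num.max r (0 : R) by rewrite le_max lexx orbT.
    apply: ge0_le_integral => //=.
    - by move=> r _; rewrite lee_fin invr_ge0 addr_ge0// mulr_ge0.
    - apply/measurable_EFinP; apply: measurable_funTS.
      by apply: continuous_measurable_fun; exact: continuous_inv_affine.
    - apply/measurable_EFinP; apply: measurable_funTS.
      by apply: continuous_measurable_fun; exact: inv_profile_continuous.
    - move=> r _; rewrite lee_fin lef_pV2 ?posrE; [exact: phi_le| |exact: phi0].
      by rewrite ltr_wpDr// mulr_ge0.
  split; [exact: a_gt0|exact: phiI|move=> h nb].
  split; last exact: complete nb.
  move=> x v; apply: le_trans (nb x v).
  have dx : 0 <= dist gR x0 x by exact: dist_ge0.
  apply: ler_wpM2l; first exact: coord_norm_ge0.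
  rewrite lef_pV2 ?posrE; [exact: phi_le|by rewrite ltr_wpDr// mulr_ge0|exact: phi0].
apply: (@complete_of_weight R n M gR h x0 (fun r : R => (a + b * Num.max r 0)^-1)) => //.
- exact: continuous_inv_affine.
- by move=> r; rewrite invr_gt0 ltr_wpDr// mulr_ge0// le_max lexx orbT.
- move=> x w; rewrite max_l; first exact: (norm_bound_coord nb).
  exact: dist_ge0.
- rewrite -[RHS](integral_inv_affine a0 b0).
  apply: eq_integral => r; rewrite inE/= in_itv/= andbT => r0.
  by rewrite max_l.
Qed.
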